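(* Let $n\ge2$. There exists a constant $C_n>0$ depending only on $n$ such that the following holds. Let $\Omega\subset\mathbb{R}^n$ be open, bounded and convex, and assume that for some $\rho>0$ $$\tilde F:=\{0\}\times B_\rho^{n-1}\subset\overline\Omega\subset[0,\infty)\times\mathbb{R}^{n-1}.$$ Let $u\in C(\overline\Omega)$ be a convex function with Monge--Ampère measure $\mu_u\ge\lambda\,dx$ in $\Omega$ for some constant $\lambda>0$, and let $u|_{\tilde F}$ be affine. Then there is an affine bijection $L:\mathbb{R}^n\to\mathbb{R}^n$ with $$F:=\{0\}\times B_2^{n-1}\subset L\tilde F\cup\overline K_{2,2}\subset L\overline\Omega\subset[0,\infty)\times\mathbb{R}^{n-1}$$ such that: (1) There exists a constant $C_{L,g}$, depending only on $L$ and $g:=u|_{\partial\Omega}$, such that for every $x\in L^{-1}K_{1,1}$ and its projection $x_0:=L^{-1}\big(0,(Lx)'\big)$ $$u(x_0)-u(x)\ge-C_{L,g}|x-x_0|+\frac{C_n\lambda^{1/n}}{|\det L|^{2/n}}\begin{cases}|L||x-x_0|\big(\tfrac12-\ln(|L||x-x_0|)\big)^{1/2}&\text{if }n=2,\\ (|L||x-x_0|)^{2/n}&\text{if } n\ge3.\end{cases}$$ In particular, $u$ is not Lipschitz continuous and not Hölder continuous with exponent $\alpha>2/n$. (2) For $n\ge2$, $\|\nabla u\|_{\infty}=\infty$. For $n\ge3$, $\|\nabla u\|_{n/(n-2)}=\infty$.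
   Context: $B_R^k\subset\mathbb{R}^k$ is the open ball of radius $R$ around the origin and $K_{h,\rho}:=(0,h)\times B_\rho^{n-1}\subset\mathbb{R}^n$. For $x=(x_1,\dots,x_n)$, $x':=(x_2,\dots,x_n)$. $|\cdot|$ is the absolute value of a number, the Euclidean norm of a vector, and the Lebesgue measure of a set. For an affine bijection $L$, $|L|$ and $\det L$ denote the spectral norm and the determinant of its linear part. $\|\cdot\|_p$ is the $L^p$ norm on $\Omega$ (essential supremum for $p=\infty$). For a convex function $u$ on $\Omega$, $\partial u(x)=\{\xi\in\mathbb{R}^n: u(y)\ge u(x)+\langle\xi,y-x\rangle\ \forall y\in\Omega\}$ and the Monge--Ampère measure is $\mu_u(A)=\big|\bigcup_{x\in A}\partial u(x)\big|$ for Borel $A\subset\Omega$. *)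

(* Defs.v *)
From HB Require Import structures.
From mathcomp Require Import all_boot all_order all_algebra.
From mathcomp Require Import all_classical all_reals all_analysis.

Set Implicit Arguments.
Unset Strict Implicit.
Unset Printing Implicit Defensive.

Import Order.TTheory GRing.Theory Num.Theory numFieldNormedType.Exports.

Local Open Scope classical_set_scope.
Local Open Scope ring_scope.

(* `|x| on 'rV[R]_n is the sup norm: it induces the usual topology, but is not the
   Euclidean norm. *)
Definition dotv (R : realType) n (x y : 'rV[R]_n) : R :=
  \sum_(i < n) x ord0 i * y ord0 i.

Definition enorm (R : realType) n (x : 'rV[R]_n) : R := Num.sqrt (dotv x x).

(* The linear part acts on row vectors, v |-> v *m A. *)
Definition spectral_norm (R : realType) n (A : 'M[R]_n) : R :=
  sup [set enorm (v *m A) | v in [set v : 'rV[R]_n | enorm v <= 1]].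

Section LebesgueMeasure.
Context {R : realType}.
Local Notation mR := (measurableTypeR R).

Definition tuple_of_cons n (p : mR * n.-tuple mR) : n.+1.-tuple mR :=
  [tuple of p.1 :: p.2].

Lemma measurable_tuple_of_cons n : measurable_fun setT (@tuple_of_cons n).
Proof. exact: (measurable_cons measurable_fst measurable_snd). Qed.

Definition lebesgue_cons n
    (mu : {sigma_finite_measure set (n.-tuple mR) -> \bar R}) :=
  pushforward (@lebesgue_measure R \x mu)%E (@tuple_of_cons n).

Section Step.
Variables (n : nat) (mu : {sigma_finite_measure set (n.-tuple mR) -> \bar R}).

Let lebesgue_cons0 : lebesgue_cons mu set0 = 0%E.
Proof. by rewrite /lebesgue_cons /pushforward preimage_set0 measure0. Qed.

Let lebesgue_cons_ge0 A : (0 <= lebesgue_cons mu A)%E.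
Proof. by rewrite /lebesgue_cons /pushforward; exact: measure_ge0. Qed.

Let lebesgue_cons_sigma_additive : semi_sigma_additive (lebesgue_cons mu).
Proof.
have mf := @measurable_tuple_of_cons n.
move=> F mF tF mUF; rewrite /lebesgue_cons /pushforward preimage_bigcup.
apply: measure_semi_sigma_additive.
- by move=> k; rewrite -[X in measurable X]setTI; exact: mf.
- apply/trivIsetP => /= i j _ _ ij; rewrite -preimage_setI.
  by move/trivIsetP : tF => /(_ _ _ _ _ ij) ->//; rewrite preimage_set0.
- by rewrite -preimage_bigcup -[X in measurable X]setTI; exact: mf.
Qed.

HB.instance Definition _ := isMeasure.Build _ _ _ (lebesgue_cons mu)
  lebesgue_cons0 lebesgue_cons_ge0 lebesgue_cons_sigma_additive.

Let lebesgue_cons_sigma_finite : sigma_finite setT (lebesgue_cons mu).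
Proof.
have /sigma_finiteP[F [TF ndF Foo]] := sigma_finiteT (@lebesgue_measure R).
have /sigma_finiteP[G [TG ndG Goo]] := sigma_finiteT mu.
pose g (t : n.+1.-tuple mR) : mR * n.-tuple mR :=
  (thead t, [tuple of behead t]).
have fK : cancel (@tuple_of_cons n) g.
  by move=> [x t]; congr pair; apply: val_inj.
have mg : measurable_fun setT g.
  apply: measurable_fun_pair; last exact: measurable_behead.
  exact: (@measurable_tnth _ mR n.+1 ord0).
exists (fun k => g @^-1` (F k `*` G k)).
  rewrite -preimage_bigcup (_ : \bigcup_k _ = setT) ?preimage_setT//.
  rewrite -subTset => -[x y] _.
  have [i _ Fx] : (\bigcup_k F k) x by rewrite -TF.
  have [j _ Gy] : (\bigcup_k G k) y by rewrite -TG.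
  exists (maxn i j) => //; split=> /=.
    by move: x Fx; exact/subsetPset/ndF/leq_maxl.
  by move: y Gy; exact/subsetPset/ndG/leq_maxr.
move=> k; have [mF Fk] := Foo k; have [mG Gk] := Goo k.
have mFG : measurable (F k `*` G k) by exact: measurableX.
split; first by rewrite -[X in measurable X]setTI; exact: mg.
rewrite /lebesgue_cons /pushforward -comp_preimage.
rewrite (_ : g \o _ = id); last by apply/funext => p /=; rewrite fK.
by rewrite preimage_id product_measure1E// lte_mul_pinfty// ge0_fin_numE.
Qed.

HB.instance Definition _ := Measure_isSigmaFinite.Build _ _ _ (lebesgue_cons mu)
  lebesgue_cons_sigma_finite.

End Step.

Fixpoint lebesgue_tuple n : {sigma_finite_measure set (n.-tuple mR) -> \bar R} :=
  if n is k.+1 then lebesgue_cons (lebesgue_tuple k) else \d_ [tuple].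

(* 'rV[R]_n carries no sigma-algebra in the library, so measures and integrals are
   computed on n.-tuple R through this bijection. *)
Definition row_of_tuple n (t : n.-tuple mR) : 'rV[R]_n := \row_i tnth t i.

(* The outer measure induced by lebesgue_tuple agrees with Lebesgue measure on all
   Lebesgue measurable sets, in particular on non-Borel ones. *)
Definition lebesgue n (A : set 'rV[R]_n) : \bar R :=
  ((lebesgue_tuple n)^*)%mu (@row_of_tuple n @^-1` A).

(* L^p norm on Om, for p in [1, +oo], computed on the extension of f by 0. *)
Definition Lp_norm n (Om : set 'rV[R]_n) (p : \bar R) (f : 'rV[R]_n -> R) : \bar R :=
  Lnorm (lebesgue_tuple n) p
    (fun t => ((f \_ Om) (row_of_tuple t))%:E).

End LebesgueMeasure.

Definition borel (T : topologicalType) : set (set T) :=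
  <<s [set U : set T | open U] >>.

Definition boundary (T : topologicalType) (A : set T) : set T :=
  closure A `\` interior A.

Section ConvexAnalysis.
Context {R : realType} {n : nat}.
Implicit Types (Om A : set 'rV[R]_n) (u : 'rV[R]_n -> R).

Definition subdifferential Om u (x : 'rV[R]_n) : set 'rV[R]_n :=
  [set xi | forall y, Om y -> u x + dotv xi (y - x) <= u y].

Definition monge_ampere Om u A : \bar R :=
  lebesgue (\bigcup_(x in A) subdifferential Om u x).

Definition affine_on A u :=
  exists (a : 'rV[R]_n) (c : R), forall x, A x -> u x = dotv a x + c.

(* A convex function is differentiable almost everywhere; the values at the other
   points are arbitrary and do not affect Lp_norm. *)
Definition gradient u (x : 'rV[R]_n) : 'rV[R]_n :=
  \row_i 'D_(delta_mx ord0 i : 'rV[R]_n) u x.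

Definition holder_on (alpha : R) A u :=
  exists C : R, forall x y, A x -> A y ->
    `|u x - u y| <= C * enorm (x - y) `^ alpha.

Definition lipschitz_on_set A u :=
  exists C : R, forall x y, A x -> A y -> `|u x - u y| <= C * enorm (x - y).

(* The function u restricted to A, as its graph: the graph determines exactly A and
   the values of u on A. *)
Definition graph_on A u : set ('rV[R]_n * R) := [set (x, u x) | x in A].

End ConvexAnalysis.

Record affine_bij (R : realType) (n : nat) := AffineBij {
  lin_part : 'M[R]_n;
  trans_part : 'rV[R]_n;
  lin_part_unit : lin_part \in unitmx }.

Section AffineBij.
Context {R : realType} {n : nat}.
Variable L : affine_bij R n.

Definition aff (x : 'rV[R]_n) : 'rV[R]_n := x *m lin_part L + trans_part L.

Definition aff_inv (y : 'rV[R]_n) : 'rV[R]_n :=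
  (y - trans_part L) *m invmx (lin_part L).

Lemma affK : cancel aff aff_inv.
Proof. by move=> x; rewrite /aff /aff_inv addrK mulmxK// lin_part_unit. Qed.

Lemma aff_invK : cancel aff_inv aff.
Proof. by move=> x; rewrite /aff /aff_inv mulmxKV ?lin_part_unit// subrK. Qed.

End AffineBij.

(* The ambient space R^(n+1), with x_1 the coordinate of index 0. *)
Section Cylinder.
Context {R : realType} {n : nat}.
Implicit Types x : 'rV[R]_n.+1.

Definition fst_coord x : R := x ord0 ord0.

Definition other_coords x : 'rV[R]_n := col' ord0 x.

Definition zero_fst x : 'rV[R]_n.+1 := \row_i (if i == ord0 then 0 else x ord0 i).

Definition cylinder (h rho : R) : set 'rV[R]_n.+1 :=
  [set x | 0 < fst_coord x < h /\ enorm (other_coords x) < rho].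

Definition flat_ball (rho : R) : set 'rV[R]_n.+1 :=
  [set x | fst_coord x = 0 /\ enorm (other_coords x) < rho].

Definition half_space : set 'rV[R]_n.+1 := [set x | 0 <= fst_coord x].

End Cylinder.

(* n is the dimension of the ambient space. Num.sqrt is 0 on negative arguments, so
   for n = 2 the value is the intended one only if 0 <= 2^-1 - ln s. *)
Definition growth (R : realType) (n : nat) (s : R) : R :=
  if n == 2%N then s * Num.sqrt (2^-1 - ln s) else s `^ (2 / n%:R).

(* Main.v *)
Require Import Defs.
From mathcomp Require Import all_boot all_order all_algebra.
From mathcomp Require Import all_classical all_reals all_analysis.
From mathcomp Require Import measurable_realfun ess_sup_inf.
From mathcomp Require Import ring lra.

(* On the slab 0 < x_1 < h the function u lies below l + C x_1, where l is the
   affine function that agrees with u on the face. Let P be a quadratic polynomial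
   with constant Hessian determinant < lambda such that u <= P on the boundary of a box.
   Then u <= P in the box: otherwise every subgradient of u over G = {u > P} would be a
   gradient of P at a point of G, so that mu_u(G) would be less than lambda |G|.
   A box touching the face, of height 2t and width w, improves the bound at its
   centre to l + C t - gamma with gamma ~ (lambda t^2 w^(2n-2))^(1/n), a gain of order
   lambda^(1/n) t^(2/n) over the linear bound. For n = 2 this gain is only linear, but
   it can be iterated: if u <= l + C x_1 - M x_1 (1 - x_2^2/w^2) for x_1 <= t, then
   for x_1 <= t/2 the constant M improves by a multiple of lambda w^2 / M, so that
   M ~ w (lambda k)^(1/2) for x_1 <= w/2^k. Growth of order
   x_1 (- ln x_1)^(1/2) or x_1^(2/n) at the face excludes Lipschitz and Hoelder bounds.
   For the gradient, convexity on lines parallel to e_1 bounds |grad u| below by chord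
   slopes, outside the null set where the one-sided derivatives differ; on infinitely
   many dyadic layers x_1 ~ 2^-i the chord slope is at least of order 2^(i(1-2/n)),
   and each of them contributes a fixed amount to the integral of
   |grad u|^(n/(n-2)). *)

Set Implicit Arguments.
Unset Strict Implicit.
Unset Printing Implicit Defensive.

Import Order.TTheory GRing.Theory Num.Theory numFieldNormedType.Exports.

Local Open Scope classical_set_scope.
Local Open Scope ring_scope.

(** * Lebesgue measure on tuples and rows *)

Section AffineMeasure.
Context {R : realType}.
Local Notation mR := (measurableTypeR R).

(** The competitor P is quadratic because its gradient map is then affine: the image of any open
    set, whatever its shape, has measure at most the Hessian determinant times that of the set.
    Since lambda bounds only mu_u from below, no equation has to be solved, and a strict inequality
    between constants gives the contradiction. For n = 2 the gain of one box is of the same order as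
    the error C x_1, so the logarithm has to come from iteration. There the mixed second derivative
    of the bound reached so far enters the determinant and must be compensated. The map L is the
    homothety with factor 8 / h, where h is the sup-norm size of a slab of Om at the face. Then |L|
    = 8 / h and |det L|^(2/n) = |L|^2, the slope 2 sup |g| / h of the linear bound is at most |L|
    sup |g|, and a constant depending only on n remains in front of the growth term. The gradient is
    not known to be measurable, so lower bounds for its norms are obtained from measurable minorants
    built of difference quotients of u. *)

Lemma lebesgue_measure_affine (a c : R) (B : set mR) : 0 < a -> measurable B ->
  lebesgue_measure ((fun t : mR => (a * t + c : mR)) @^-1` B)
    = ((a^-1)%:E * lebesgue_measure B)%E.
Proof.
move=> a0 mB.
pose f : mR -> mR := fun t => (a * t + c : mR).
have mf : measurable_fun setT f.
  by apply: measurable_funD => //; exact: measurable_funM.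
pose mu := mscale (NngNum (ltW a0)) (pushforward lebesgue_measure f).
have key : lebesgue_measure B = mu mf B.
  apply: (@lebesgue_measure_unique R (mu mf)) => // X [[x y] _ <-] /=.
  have pre : f @^-1` `]x, y]%classic = `](x - c) / a, (y - c) / a]%classic.
    by apply/seteqP; split => t /=; rewrite /f !in_itv /= ltr_pdivrMr// ler_pdivlMr//
      ltrBlDr lerBrDr [t * a]mulrC.
  transitivity (a%:E * lebesgue_measure (f @^-1` `]x, y]%classic))%E; last by [].
  rewrite pre !lebesgue_measure_itv /=.
  rewrite !lte_fin ltr_pM2r ?invr_gt0// ltrD2r.
  case: ifPn => _; last by rewrite mule0.
  by rewrite -!EFinB -EFinM; congr EFin; field; rewrite gt_eqF.
rewrite key; have -> : mu mf B = (a%:E * lebesgue_measure (f @^-1` B))%E by [].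
by rewrite muleA -EFinM mulVf ?gt_eqF// mul1e.
Qed.

Lemma behead_tuple_of_cons n (p : mR * n.-tuple mR) :
  [tuple of behead (tuple_of_cons p)] = p.2.
Proof. exact: val_inj. Qed.

(** [c] is the inverse of the Jacobian determinant. Scaling of preimages is stable under composition
    and refers to no inverse of [T]. *)
Definition scales n (T : n.-tuple mR -> n.-tuple mR) (c : R) :=
  measurable_fun setT T /\
  forall B, measurable B -> lebesgue_tuple n (T @^-1` B) = (c%:E * lebesgue_tuple n B)%E.

Lemma lebesgue_tupleSE n (B : set (n.+1.-tuple mR)) :
  lebesgue_tuple n.+1 B =
  (lebesgue_measure \x lebesgue_tuple n)%E (@tuple_of_cons R n @^-1` B).
Proof. by []. Qed.

Lemma measurable_preimage_cons n (B : set (n.+1.-tuple mR)) : measurable B ->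
  measurable (@tuple_of_cons R n @^-1` B).
Proof.
by move=> mB; rewrite -[X in measurable X]setTI; exact: measurable_tuple_of_cons.
Qed.

(** The measure on tuples integrates over the head outermost; changing the head at a fixed tail
    needs the other order. *)
Lemma product_measure12 n (A : set (mR * n.-tuple mR)) : measurable A ->
  ((lebesgue_measure \x lebesgue_tuple n) A =
   (lebesgue_measure \x^ lebesgue_tuple n) A)%E.
Proof.
move=> mA; apply: product_measure_unique => // X Y mX mY.
exact: product_measure2E.
Qed.

(** Fubini with the tail fixed: on each line the map is affine in the head and contributes a^-1,
    whatever the translation [phi]; what remains is the change of variables [S] in the tail. *)
Lemma scales_head n (S : n.-tuple mR -> n.-tuple mR) (c : R)
    (phi : n.-tuple mR -> mR) (a : R) : 0 < a -> 0 <= c -> scales S c ->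
  measurable_fun setT phi ->
  scales (fun x : n.+1.-tuple mR =>
    @tuple_of_cons R n (a * thead x + phi [tuple of behead x],
                        S [tuple of behead x])) (a^-1 * c).
Proof.
move=> a0 c0 [mS HS] mphi; set T := (X in scales X).
have mT : measurable_fun setT T.
  apply: (measurableT_comp (@measurable_tuple_of_cons R n)).
  apply: measurable_fun_pair.
    apply: measurable_funD.
      by apply: measurable_funM => //; exact: (@measurable_tnth _ mR n.+1 ord0).
    by apply: measurableT_comp => //; exact: measurable_behead.
  by apply: measurableT_comp => //; exact: measurable_behead.
split => // B mB.
rewrite !lebesgue_tupleSE !product_measure12 /product_measure2; last 2 first.
- exact: measurable_preimage_cons.
- apply: measurable_preimage_cons; rewrite -[X in measurable X]setTI; exact: mT.
set B' := @tuple_of_cons R n @^-1` B.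
have mB' : measurable B' by exact: measurable_preimage_cons.
pose g y := lebesgue_measure (ysection B' y).
have mg : measurable_fun setT g by exact: (measurable_fun_ysection lebesgue_measure mB').
transitivity (\int[lebesgue_tuple n]_y ((a^-1)%:E * g (S y)))%E.
  apply: eq_integral => y _ /=.
  rewrite -(@lebesgue_measure_affine _ (phi y) (ysection B' (S y)) a0);
    last exact: measurable_ysection.
  congr (lebesgue_measure _); apply/seteqP; split => t /=;
  by rewrite /ysection /= !inE /B' /= /T behead_tuple_of_cons.
rewrite ge0_integralZl//; last 2 first.
- exact: (measurableT_comp mg).
- by rewrite lee_fin invr_ge0 ltW.
rewrite EFinM -muleA; congr (_ * _)%E.
transitivity (\int[pushforward (lebesgue_tuple n) S]_y g y)%E.
  by rewrite ge0_integral_pushforward// => y _; exact: measure_ge0.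
transitivity (\int[mscale (NngNum c0) (lebesgue_tuple n)]_y g y)%E.
  by apply: eq_measure_integral => A mA _; rewrite /= /mscale /pushforward /= HS.
by rewrite ge0_integral_mscale// => y _; exact: measure_ge0.
Qed.

(** Fubini with the head fixed: [S] may depend on the head because the factor [c] does not. *)
Lemma scales_tail n (S : mR -> n.-tuple mR -> n.-tuple mR) (c : R) : 0 <= c ->
  (forall t, scales (S t) c) ->
  measurable_fun setT (fun p : mR * n.-tuple mR => S p.1 p.2) ->
  scales (fun x : n.+1.-tuple mR =>
    @tuple_of_cons R n (thead x, S (thead x) [tuple of behead x])) c.
Proof.
move=> c0 HS mS; set T := (X in scales X).
have mT : measurable_fun setT T.
  apply: (measurableT_comp (@measurable_tuple_of_cons R n)).
  have m0 : measurable_fun setT (@thead n mR : n.+1.-tuple mR -> mR).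
    exact: (@measurable_tnth _ mR n.+1 ord0).
  apply: measurable_fun_pair => //.
  have mB : measurable_fun setT
      (fun x : n.+1.-tuple mR => (thead x, [tuple of behead x]) : mR * n.-tuple mR).
    by apply: measurable_fun_pair => //; exact: measurable_behead.
  exact: (measurableT_comp mS mB).
split => // B mB.
rewrite !lebesgue_tupleSE /product_measure1.
set B' := @tuple_of_cons R n @^-1` B.
have mB' : measurable B' by exact: measurable_preimage_cons.
rewrite -ge0_integralZl//; last first.
- exact: (measurable_fun_xsection (lebesgue_tuple n) mB').
apply: eq_integral => t _ /=; rewrite -(HS t).2; last exact: measurable_xsection.
congr (lebesgue_tuple n _); apply/seteqP; split => y /=;
by rewrite /xsection /= !inE /B' /= /T behead_tuple_of_cons.
Qed.

Lemma scales_comp n (T S : n.-tuple mR -> n.-tuple mR) (c d : R) :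
  scales T c -> scales S d -> scales (T \o S) (d * c).
Proof.
move=> [mT HT] [mS HS]; split; first exact: measurableT_comp.
move=> B mB; rewrite comp_preimage HS; last by rewrite -[X in measurable X]setTI; exact: mT.
by rewrite HT// muleA EFinM.
Qed.

Lemma scales_diag n (c d : 'I_n -> R) : (forall i, 0 < c i) ->
  scales (fun x : n.-tuple mR => [tuple (c i * tnth x i + d i : mR) | i < n])
    (\prod_i (c i)^-1).
Proof.
elim: n c d => [|n IH] c d c0.
  split; first by apply/measurable_fun_tnthP => -[].
  move=> B mB; rewrite big_ord0 mul1e; congr (lebesgue_tuple 0 _).
  apply/funext => x /=; congr (B _).
  by rewrite (tuple0 x); apply: val_inj; rewrite /= enum_ord0.
have := @scales_head n _ _ (fun=> d ord0) (c ord0) (c0 _) _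
  (IH (c \o lift ord0) (d \o lift ord0) (fun i => c0 _)) (measurable_cst _).
have -> : \prod_i (c i)^-1 = (c ord0)^-1 * \prod_(i < n) ((c \o lift ord0) i)^-1.
  by rewrite big_ord_recl.
have -> // : (fun x : n.+1.-tuple mR => [tuple (c i * tnth x i + d i : mR) | i < n.+1]) =
   (fun x => @tuple_of_cons R n (c ord0 * thead x + d ord0,
     [tuple ((c \o lift ord0) i * tnth [tuple of behead x] i + (d \o lift ord0) i : mR) | i < n])).
  apply/funext => x; apply: eq_from_tnth => i; rewrite tnth_mktuple.
  case: (unliftP ord0 i) => [j ->|->] //.
  by rewrite {1}(tuple_eta x) !tnthS tnth_mktuple.
move=> H; apply: H; apply: prodr_ge0 => i _; rewrite invr_ge0; exact: ltW (c0 _).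
Qed.

End AffineMeasure.

(** * Open sets of row vectors: measurability, size, affine images *)

Section RowMeasure.
Context {R : realType}.
Local Notation mR := (measurableTypeR R).

Definition cube n (c : 'I_n -> R) (r : R) : set (n.-tuple mR) :=
  [set t | forall i, ball (c i) r (tnth t i : R)].

Lemma measurable_cube n (c : 'I_n -> R) r : measurable (cube c r).
Proof.
rewrite (_ : cube c r = \bigcap_(i in [set: 'I_n])
   ((fun t : n.-tuple mR => tnth t i) @^-1` ball (c i) r)); last first.
  by apply/seteqP; split => t /= H i; [move=> _; exact: H|exact: H].
apply: fin_bigcap_measurable => // i _.
rewrite -[X in measurable X]setTI; apply: measurable_tnth => //.
exact: measurable_ball.
Qed.

Lemma lebesgue_cube n (c : 'I_n -> R) r : 0 <= r ->
  lebesgue_tuple n (cube c r) = ((r *+ 2) ^+ n)%:E.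
Proof.
move=> r0; elim: n c => [|n IH] c.
  rewrite expr0 /=.
  rewrite (_ : cube c r = setT); first by rewrite diracT.
  by rewrite -subTset => t _ [].
rewrite lebesgue_tupleSE.
rewrite (_ : _ @^-1` _ = ball (c ord0) r `*` cube (c \o lift ord0) r); last first.
  apply/seteqP; split => [[x t] /= H|[x t] /= [H0 H] i].
    by split => [|i /=]; [exact: (H ord0)|have := H (lift ord0 i); rewrite tnthS].
  by case: (unliftP ord0 i) => [j ->|->] //; rewrite tnthS; exact: H.
rewrite product_measure1E; [|exact: measurable_ball|exact: measurable_cube].
rewrite [X in (X * _)%E](lebesgue_measure_ball _ r0).
by rewrite (IH (c \o lift ord0)) -EFinM exprS.
Qed.

Lemma ball_rowP n (x : 'rV[R]_n) r (t : n.-tuple mR) : 0 < r ->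
  ball x r (row_of_tuple t) <-> cube (x ord0) r t.
Proof.
move=> r0; split => [[_ H] i|H].
  by have := H ord0 i; rewrite mxE.
by split => // i j; rewrite mxE ord1; exact: H.
Qed.

(** An open set is the union of the balls with rational centre and radius 1/(k+1) that it contains,
    and each of them pulls back to a [cube]. Encoding centre and radius by [pickle] makes the union
    countable. *)
Lemma open_measurable_row n (U : set 'rV[R]_n) : open U ->
  measurable (@row_of_tuple R n @^-1` U).
Proof.
move=> oU.
pose c (q : 'rV[rat]_n * nat) : 'rV[R]_n := map_mx (@ratr R) q.1.
pose V (q : 'rV[rat]_n * nat) : set 'rV[R]_n := ball (c q) (q.2.+1%:R^-1).
have -> : @row_of_tuple R n @^-1` U = \bigcup_k
   (match unpickle k with
    | Some q => if `[< V q `<=` U >] then cube (c q ord0) (q.2.+1%:R^-1) else set0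
    | None => set0 end).
  apply/seteqP; split => [t /= Ut|t [k _]]; last first.
    case: unpickle => // q; case: asboolP => // VU Hc.
    by apply: VU; apply/ball_rowP.
  have [e /= e0 eU] : exists2 e, 0 < e & ball (row_of_tuple t) e `<=` U.
    by apply/nbhs_ballP; exact: oU.
  have [k Hk] : exists k : nat, 0 + k.+1%:R^-1 < e / 2.
    by apply: ltr_add_invr; rewrite divr_gt0.
  rewrite add0r in Hk.
  have r0 : 0 < k.+1%:R^-1 :> R by [].
  have Hx i : exists q : rat, `|tnth t i - ratr q : R| < k.+1%:R^-1.
    have : tnth t i - k.+1%:R^-1 < tnth t i + k.+1%:R^-1 :> R.
      by rewrite ltrBlDr -addrA ltrDl addr_gt0.
    move/rat_in_itvoo => [q]; rewrite in_itv /= => /andP[q1 q2]; exists q.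
    by rewrite distrC ltr_distl q1.
  have [q Hq] := choice Hx.
  exists (pickle (\row_i q i, k)) => //; rewrite pickleK.
  have cc : cube (c (\row_i q i, k) ord0) k.+1%:R^-1 t.
    move=> i; rewrite /c !mxE /=; apply: ball_sym; exact: Hq.
  case: asboolP => // H; exfalso; apply: H => y Vy; apply: eU.
  have Vt : V (\row_i q i, k) (row_of_tuple t) by apply/ball_rowP.
  rewrite (splitr e); apply: (ball_triangle (y := c (\row_i q i, k))).
    by apply: ball_sym; apply: le_ball Vt; exact: ltW.
  by apply: le_ball Vy; exact: ltW.
apply: bigcupT_measurable => k; case: unpickle => // q.
by case: asboolP => // _; exact: measurable_cube.
Qed.

Lemma lebesgue_measurableE n (U : set 'rV[R]_n) :
  measurable (@row_of_tuple R n @^-1` U) ->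
  lebesgue U = lebesgue_tuple n (@row_of_tuple R n @^-1` U).
Proof. by move=> mU; rewrite /lebesgue measurable_mu_extE. Qed.

Lemma le_lebesgue n (A B : set 'rV[R]_n) : A `<=` B ->
  (lebesgue A <= lebesgue B)%E.
Proof. by move=> AB; apply: le_mu_ext => t; exact: AB. Qed.

Lemma lebesgue_open_gt0 n (U : set 'rV[R]_n) x : open U -> U x ->
  (0 < lebesgue U)%E.
Proof.
move=> oU Ux; rewrite lebesgue_measurableE; last exact: open_measurable_row.
have [e /= e0 eU] : exists2 e, 0 < e & ball x e `<=` U.
  by apply/nbhs_ballP; exact: oU.
apply: (@lt_le_trans _ _ (lebesgue_tuple n (cube (x ord0) e))).
  by rewrite lebesgue_cube ?ltW// lte_fin exprn_gt0// pmulrn_lgt0.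
apply: le_measure; rewrite ?inE; [exact: measurable_cube|exact: open_measurable_row|].
by move=> t /(ball_rowP _ _ e0) /eU.
Qed.

Lemma lebesgue_bounded_lty n (U : set 'rV[R]_n) x r : open U -> 0 < r ->
  U `<=` ball x r -> (lebesgue U < +oo)%E.
Proof.
move=> oU r0 Ur; rewrite lebesgue_measurableE; last exact: open_measurable_row.
apply: (@le_lt_trans _ _ (lebesgue_tuple n (cube (x ord0) r))).
  apply: le_measure; rewrite ?inE; [exact: open_measurable_row|exact: measurable_cube|].
  by move=> t /Ur /(ball_rowP _ _ r0).
by rewrite lebesgue_cube ?ltW// ltry.
Qed.

Definition tuple_of_row n (x : 'rV[R]_n) : n.-tuple mR := [tuple (x ord0 i : mR) | i < n].

Lemma row_of_tupleK n : cancel (@row_of_tuple R n) (@tuple_of_row n).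
Proof. by move=> t; apply: eq_from_tnth => i; rewrite tnth_mktuple mxE. Qed.

Lemma tuple_of_rowK n : cancel (@tuple_of_row n) (@row_of_tuple R n).
Proof. by move=> x; apply/rowP => i; rewrite mxE tnth_mktuple. Qed.

(* As an upper bound through outer measure, so that the image under the gradient
   need not be shown measurable. *)
Lemma scales_image n (S : n.-tuple mR -> n.-tuple mR) (c : R)
    (T : 'rV[R]_n -> 'rV[R]_n) (U : set 'rV[R]_n) :
  scales S c -> (forall x, S (tuple_of_row (T x)) = tuple_of_row x) ->
  open U -> (lebesgue (T @` U) <= c%:E * lebesgue U)%E.
Proof.
move=> [mS HS] ST oU.
have mU := open_measurable_row oU.
rewrite [leRHS](_ : _ = lebesgue ((fun y => row_of_tuple (S (tuple_of_row y))) @^-1` U)).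
  by apply: le_lebesgue => _ [x Ux <-] /=; rewrite ST tuple_of_rowK.
have e : @row_of_tuple R n @^-1` ((fun y => row_of_tuple (S (tuple_of_row y))) @^-1` U)
    = S @^-1` (@row_of_tuple R n @^-1` U).
  by apply/seteqP; split => t /=; rewrite row_of_tupleK.
rewrite [RHS]lebesgue_measurableE; last first.
  by rewrite e -[X in measurable X]setTI; exact: mS.
by rewrite e HS// lebesgue_measurableE.
Qed.

Lemma scales_image_diag n (c d : 'I_n -> R) (U : set 'rV[R]_n) :
  (forall i, 0 < c i) -> open U ->
  (lebesgue ((fun x : 'rV[R]_n => \row_i (c i * x ord0 i + d i))%R @` U)
     <= (\prod_i c i)%R%:E * lebesgue U)%E.
Proof.
move=> c0 oU.
have c0' i : 0 < (c i)^-1 by rewrite invr_gt0.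
have := scales_diag (fun i => - (d i / c i)) c0'.
rewrite (eq_bigr c); last by move=> i _; rewrite invrK.
move=> sc; apply: (scales_image sc) => // x.
apply: eq_from_tnth => i; rewrite !tnth_mktuple mxE.
by field; rewrite gt_eqF.
Qed.

(* The symmetric matrix [[a, b], [b, c]] factors through a shear in each coordinate. *)
Lemma scales_image2 (a b c : R) (d : 'rV[R]_2) (U : set 'rV[R]_2) :
  0 < a -> 0 < a * c - b ^+ 2 -> open U ->
  (lebesgue ((fun x : 'rV[R]_2 => d + \row_i
     (if i == ord0 then a * x ord0 ord0 + b * x ord0 (lift ord0 ord0)
      else b * x ord0 ord0 + c * x ord0 (lift ord0 ord0)))%R @` U)
     <= (a * c - b ^+ 2)%R%:E * lebesgue U)%E.
Proof.
set D := a * c - _ => a0 D0 oU.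
pose d1 : R := d ord0 ord0. pose d2 : R := d ord0 (lift ord0 ord0).
have aD : 0 < a / D by rewrite divr_gt0.
(* The inverse is taken in two steps: [S1] recovers the second coordinate from the image (t, y),
   with factor D / a, and [phi] then recovers the first one, with factor a. *)
pose S1 := fun (t : mR) (y : 1.-tuple mR) => [tuple (a / D * tnth y i
   + (- (d2 * (a / D)) - b / D * (t - d1)) : mR) | i < 1].
have s1 t : scales (S1 t) (D / a).
  have := @scales_diag R 1 (fun=> a / D) (fun=> - (d2 * (a / D)) - b / D * (t - d1)) (fun=> aD).
  by rewrite big_ord1 invf_div.
have Da : 0 <= D / a by rewrite divr_ge0// ltW.
have mS1 : measurable_fun setT (fun p : mR * 1.-tuple mR => S1 p.1 p.2).
  apply/measurable_fun_tnthP => i.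
  rewrite (_ : _ \o _ = fun p : mR * 1.-tuple mR => a / D * tnth p.2 i +
     (- (d2 * (a / D)) - b / D * (p.1 - d1)) : mR); last first.
    by apply/funext => p /=; rewrite tnth_mktuple.
  have m2 : measurable_fun setT (fun p : mR * 1.-tuple mR => tnth p.2 i).
    exact: (measurableT_comp (@measurable_tnth _ mR 1 i) measurable_snd).
  apply: measurable_funD; first exact: measurable_funM.
  apply: measurable_funB => //; apply: measurable_funM => //.
  exact: measurable_funB.
have sT := scales_tail Da s1 mS1.
pose phi : 1.-tuple mR -> mR := fun y => - ((d1 + b * tnth y ord0) / a).
have mphi : measurable_fun setT phi.
  have m2 : measurable_fun setT (fun p : 1.-tuple mR => tnth p ord0).
    exact: measurable_tnth.
  apply: measurable_funN; apply: measurable_funM => //.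
  by apply: measurable_funD => //; exact: measurable_funM.
have sid : scales (@id (1.-tuple mR)) 1 by split => // B mB; rewrite mul1e.
have ai : 0 < a^-1 by rewrite invr_gt0.
have := scales_comp (scales_head ai ler01 sid mphi) sT.
rewrite invrK mulr1 mulfVK ?gt_eqF// => sc.
apply: (scales_image sc) => // x.
have Ew (y : 'rV[R]_2) : tuple_of_row y =
    tuple_of_cons (y ord0 ord0, [tuple (y ord0 (lift ord0 ord0) : mR) | i < 1]).
  apply: eq_from_tnth => i; rewrite tnth_mktuple.
  by case: (unliftP ord0 i) => [j ->|->] //; rewrite tnthS tnth_mktuple (ord1 j).
pose x0 := x ord0 ord0; pose x1 := x ord0 (lift ord0 ord0).
pose p : mR := d1 + (a * x0 + b * x1); pose q : mR := d2 + (b * x0 + c * x1).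
have ES : S1 p [tuple q | i < 1] = [tuple (x1 : mR) | i < 1].
  apply: eq_from_tnth => i; rewrite !tnth_mktuple /p /q.
  have Dn : a * c - b ^+ 2 != 0 by exact: lt0r_neq0.
  by rewrite /D; field.
rewrite !Ew !mxE /= -/x0 -/x1 -/d1 -/d2 -/p -/q.
rewrite !behead_tuple_of_cons /= ES.
rewrite !theadE; congr (tuple_of_cons (_, _)).
rewrite /phi tnth_mktuple /p /=.
suff F (e f g : R) : a^-1 * (g + (a * e + b * f)) - (g + b * f) / a = e by exact: F.
by field; exact: lt0r_neq0.
Qed.

End RowMeasure.

(** * Comparison with quadratic polynomials *)

Section Comparison.
Context {R : realType} {n : nat}.
Implicit Types (x y : 'rV[R]_n).

Lemma dotvDr (a x y : 'rV[R]_n) : dotv a (x + y) = dotv a x + dotv a y.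
Proof. by rewrite /dotv -big_split; apply: eq_bigr => i _; rewrite mxE mulrDr. Qed.

Lemma dotvZr (a x : 'rV[R]_n) s : dotv a (s *: x) = s * dotv a x.
Proof. by rewrite /dotv mulr_sumr; apply: eq_bigr => i _; rewrite mxE mulrCA. Qed.

Lemma dotvNr (a x : 'rV[R]_n) : dotv a (- x) = - dotv a x.
Proof. by rewrite -scaleN1r dotvZr mulN1r. Qed.

Lemma dotv_delta (a : 'rV[R]_n) i : dotv a (delta_mx 0 i) = a 0 i.
Proof.
rewrite /dotv (bigD1 i)//= mxE !eqxx mulr1 big1 ?addr0// => j ji.
by rewrite mxE (negbTE ji) andbF mulr0.
Qed.

Lemma continuous_dotv (a : 'rV[R]_n) : continuous (fun x => dotv a x).
Proof.
apply: continuous_big => [|i _ x]; first exact: (@add_continuous R).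
apply: (@continuousM _ 'rV[R]_n (fun=> a ord0 i) (fun y : 'rV[R]_n => y ord0 i)); last exact: coord_continuous.
exact: cst_continuous.
Qed.

Lemma normr_delta_le (i : 'I_n) : `|delta_mx 0 i : 'rV[R]_n| <= 1.
Proof.
rewrite /Num.Def.normr /= mx_normrE; apply/bigmax_leP; split => // -[j k] _ /=.
by rewrite mxE; case: andP; rewrite ?normr1 ?normr0.
Qed.

Lemma continuous_translation (v : 'rV[R]_n) : continuous (fun x => x + v).
Proof. by move=> x; apply: continuousD; [|exact: cst_continuous]. Qed.

(** Replace the closure point x by a nearby x' of [Om] and let y absorb the error: the shifted point
    y' still lies in a ball around y inside [Om]. *)
Lemma segment_in_interior (Om : set 'rV[R]_n) x y t : open Om ->
  @convex_set R 'rV[R]_n Om -> closure Om x -> Om y -> 0 < t <= 1 ->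
  Om (t *: y + (1 - t) *: x).
Proof.
move=> oOm cOm clx Oy /andP[t0 t1].
have [e /= e0 eO] : exists2 e, 0 < e & ball y e `<=` Om.
  by apply/nbhs_ballP; exact: oOm.
have [x' [Ox' xx']] := clx _ (nbhsx_ballx x (t * e) (mulr_gt0 t0 e0)).
pose y' := y + ((1 - t) / t) *: (x - x').
have Oy' : Om y'.
  apply: eO; rewrite -ball_normE /= opprD addNKr normrN normrZ ger0_norm; last first.
    by rewrite divr_ge0 ?subr_ge0// ltW.
  rewrite -ball_normE /= in xx'.
  rewrite mulrAC ltr_pdivrMr// [e * t]mulrC.
  apply: le_lt_trans xx'; apply: ler_piMl => //.
  by rewrite lerBlDr lerDl ltW.
have t01 : (0 <= t <= 1)%R by rewrite (ltW t0).
pose tt := Itv01 (ltW t0) t1.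
have := @cOm y' x' tt (mem_set Oy') (mem_set Ox').
rewrite inE; congr (Om _).
rewrite /conv /= /y' scalerDr scalerA mulrC divfK ?gt_eqF//.
by rewrite /unstable.onem -addrA -scalerDr subrK.
Qed.

Variables (Om : set 'rV[R]_n) (u : 'rV[R]_n -> R) (lambda : R).
Hypotheses (oOm : open Om) (cOm : @convex_set R 'rV[R]_n Om).
Hypotheses (ctu : {within closure Om, continuous u})
  (cvu : @convex_function R 'rV[R]_n (closure Om) u).
Hypotheses (MA : forall A : set 'rV[R]_n, borel A -> A `<=` Om ->
       (lambda%:E * lebesgue A <= monge_ampere Om u A)%E).

Lemma convex_function_le x y t : closure Om x -> closure Om y -> 0 <= t <= 1 ->
  u (t *: x + (1 - t) *: y) <= t * u x + (1 - t) * u y.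
Proof.
move=> Ox Oy /andP[t0 t1].
have := @cvu (Itv01 t0 t1) x y; rewrite !inE => H; exact: H.
Qed.

Lemma continuous_in_open x : Om x -> {for x, continuous u}.
Proof.
move=> Ox; have : {within Om, continuous u}.
  exact: continuous_subspaceW (@subset_closure _ Om) ctu.
by rewrite continuous_open_subspace// => /(_ x); apply; rewrite inE.
Qed.

(* The midpoint of x and a boundary point lies in Om, where the supporting
   plane is below u; as it touches u at x, it stays below u at the boundary. *)
Lemma subdifferential_closure x xi y : Om x -> subdifferential Om u x xi ->
  closure Om y -> u x + dotv xi (y - x) <= u y.
Proof.
move=> Ox sub Oy.
have h : (0 < (2^-1 : R) <= 1)%R by lra.
have := sub _ (segment_in_interior oOm cOm Oy Ox h).
have h' : (0 <= (2^-1 : R) <= 1)%R by lra.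
have := convex_function_le (subset_closure Ox) Oy h'.
have -> : 2^-1 *: x + (1 - 2^-1) *: y - x = 2^-1 *: (y - x).
  apply/rowP => i; rewrite !mxE; lra.
rewrite dotvZr; lra.
Qed.

Lemma linear_part_eq0 (d k e : R) : 0 < e ->
  (forall s, `|s| < e -> 0 <= s * d + s ^+ 2 * k) -> d = 0.
Proof.
move=> e0 H; apply/eqP; apply/negPn/negP => d0.
have d2 : 0 < d ^+ 2 by rewrite exprn_even_gt0.
have nd : 0 < `|d| by rewrite normr_gt0.
(* At s = - d / q the quadratic is d^2 / q * (k / q - 1). The summand |d| / e gives |s| < e, and q >
   |k| makes the value negative. *)
pose q := 1 + `|k| + `|d| / e.
have de : 0 < `|d| / e by rewrite divr_gt0.
have q0 : 0 < q by rewrite /q; have := normr_ge0 k; lra.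
have : `|- (d / q)| < e.
  rewrite normrN normrM normfV (ger0_norm (ltW q0)) ltr_pdivrMr// /q.
  rewrite !mulrDr mulrCA divff ?gt_eqF// !mulr1.
  have : 0 <= e * `|k| by rewrite mulr_ge0// ltW.
  lra.
move/H; rewrite (_ : _ + _ = d ^+ 2 / q * (k / q - 1)); last by field; rewrite gt_eqF.
rewrite pmulr_rge0 ?divr_gt0// subr_ge0 ler_pdivlMr// mul1r leNgt => /negP; apply.
rewrite /q; have := ler_norm k; lra.
Qed.

(** [g] is the gradient of [P] and 2 [kap] i are its pure second derivatives; expansions along the
    axes suffice to identify the gradient at a minimum. The chain lambda |G| <= mu_u(G) <= |g(G)| <=
    c |G| contradicts c < lambda because 0 < |G| < oo. *)
Lemma comparison (D K : set 'rV[R]_n) (P : 'rV[R]_n -> R)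
    (g : 'rV[R]_n -> 'rV[R]_n) (kap : 'I_n -> R) (c : R) :
  open D -> D `<=` Om -> D `<=` K -> K `<=` closure Om -> compact K ->
  continuous P ->
  (forall y i s, P (y + s *: delta_mx 0 i) = P y + s * g y 0 i + s ^+ 2 * kap i) ->
  (forall U, open U -> (lebesgue (g @` U) <= c%:E * lebesgue U)%E) ->
  c < lambda ->
  (forall y, K y -> ~ D y -> u y <= P y) ->
  forall y, D y -> u y <= P y.
Proof.
move=> oD DOm DK KOm cK cP Pg lg cl Pbd y0 Dy0; rewrite leNgt; apply/negP => Py0.
pose f := fun y => u y - P y.
pose G := D `&` [set y | 0 < f y].
have Gy0 : G y0 by split => //=; rewrite /f subr_gt0.
have oG : open G.
  rewrite openE => y [Dy fy]; rewrite /interior; apply: filterI; first exact: oD.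
  have cf : {for y, continuous f}.
    by apply: continuousB; [exact/continuous_in_open/DOm|exact: cP].
  by apply: (cf [set z | 0 < z]); apply: open_nbhs_nbhs; split => //; exact: open_gt.
have GOm : G `<=` Om by move=> y [/DOm].
have Gfin : (lebesgue G < +oo)%E.
  have [M [_ KM]] := compact_bounded cK.
  have M0 : 0 < `|M| + 2 by rewrite ltr_wpDl.
  apply: (@lebesgue_bounded_lty _ _ _ 0 _ oG M0) => y [/DK Ky _].
  have := KM (`|M| + 1) _ y Ky; rewrite -ball_normE /= sub0r normrN => h.
  have : `|y| <= `|M| + 1.
    by apply: h; rewrite (le_lt_trans (ler_norm M))// ltrDl.
  lra.
have G0 : (0 < lebesgue G)%E by exact: lebesgue_open_gt0 Gy0.
(* Let y minimise P - <xi, .> on [K]. As P x < u x, P lies below the supporting plane of u at y, so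
   P y < u y. By [Pbd] the point y is then in [D], hence in [G], and at this interior minimum g y =
   xi. *)
have sub : \bigcup_(x in G) subdifferential Om u x `<=` g @` G.
  move=> xi [x Gx sub].
  have [Ox [Dx]] := (GOm _ Gx, Gx); rewrite /= /f subr_gt0 => Px.
  pose l y := u x + dotv xi (y - x).
  have cl' : continuous (fun y => P y - dotv xi y).
    by move=> y; apply: continuousB; [exact: cP|exact: continuous_dotv].
  have K0 : K !=set0 by exists x; exact: DK.
  have [y Ky ymin] := compact_EVT_min K0 cK (continuous_subspaceT cl').
  rewrite inE in Ky.
  have Ply : P y < l y.
    have := ymin x (mem_set (DK _ Dx)); rewrite /l dotvDr dotvNr; lra.
  have lu : l y <= u y by apply: subdifferential_closure => //; exact: KOm.
  have Py : P y < u y by exact: lt_le_trans lu.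
  have Dy : D y.
    by apply: contrapT => /(Pbd _ Ky); rewrite leNgt Py.
  exists y; first by split => //=; rewrite /f subr_gt0.
  have [e /= e0 eD] : exists2 e, 0 < e & ball y e `<=` D.
    by apply/nbhs_ballP; exact: oD.
  apply/rowP => i.
  have key s : `|s| < e -> 0 <= s * (g y 0 i - xi 0 i) + s ^+ 2 * kap i.
    move=> se.
    have Ks : K (y + s *: delta_mx 0 i).
      apply/DK/eD; rewrite -ball_normE /= opprD addNKr normrN normrZ.
      apply: le_lt_trans se; apply: ler_piMr => //.
      exact: normr_delta_le.
    have := ymin _ (mem_set Ks); rewrite dotvDr dotvZr dotv_delta Pg; lra.
  apply/eqP; rewrite -subr_eq0; apply/eqP.
  exact: linear_part_eq0 e0 key.
have bG : borel G by apply: sub_sigma_algebra; exact: oG.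
have := MA bG GOm.
have := le_trans (le_lebesgue sub) (lg _ oG).
rewrite /monge_ampere => h1 h2; have := le_trans h2 h1.
have Gf : lebesgue G \is a fin_num by rewrite ge0_fin_numE ?ltW.
rewrite -(fineK Gf) -!EFinM lee_fin ler_pM2r; first by rewrite leNgt cl.
by rewrite fine_gt0// G0.
Qed.

End Comparison.

(** * Barriers on boxes touching the face *)

Section Barriers.
Context {R : realType}.

Lemma rV_norm_lt n (x : 'rV[R]_n) (h : R) : 0 < h ->
  (`|x| < h) <-> (forall i, `|x 0 i| < h).
Proof.
move=> h0; rewrite /Num.Def.normr /= mx_normrE; split => [/bigmax_ltP[_ H] i|H].
  exact: (H (0, i)).
by apply/bigmax_ltP; split => // -[j i] _ /=; rewrite (ord1 j); exact: H.
Qed.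

Definition box n (y : 'rV[R]_n) (r : 'I_n -> R) : set 'rV[R]_n :=
  [set x | forall i, `|x 0 i - y 0 i| < r i].

Definition cbox n (y : 'rV[R]_n) (r : 'I_n -> R) : set 'rV[R]_n :=
  [set x | forall i, `|x 0 i - y 0 i| <= r i].

Lemma open_box n (y : 'rV[R]_n) r : open (box y r).
Proof.
rewrite openE => x Hx; rewrite /interior.
have H i : nbhs x [set z : 'rV[R]_n | `|z 0 i - y 0 i| < r i].
  have cf : {for x, continuous (fun z : 'rV[R]_n => `|z 0 i - y 0 i|)}.
    apply: (@continuous_comp _ _ _ (fun z : 'rV[R]_n => z 0 i - y 0 i) (fun s => `|s|)).
      by apply: continuousB; [exact: coord_continuous|exact: cst_continuous].
    exact: norm_continuous.
  by apply: (cf [set s | s < r i]); apply: open_nbhs_nbhs; split; [exact: open_lt|exact: Hx].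
exact: filter_forall H.
Qed.

Lemma compact_cbox n (y : 'rV[R]_n) r : compact (cbox y r).
Proof.
have := @rV_compact R n (fun i => `[y 0 i - r i, y 0 i + r i]%classic)
  (fun i => @segment_compact R _ _).
congr compact; apply/seteqP; split => x /= H i; have := H i;
  by rewrite in_itv /= ler_distl.
Qed.

(** The local situation near the origin on which all estimates rest, with sizes in the sup norm.
    That [a] has first entry 0 costs nothing on the face and makes the affine function constant
    along e_1. [C] is the slope of the linear bound. *)
Record flat_setting n (Om : set 'rV[R]_n.+2) (u : 'rV[R]_n.+2 -> R)
    (lambda h C c0 : R) (a : 'rV[R]_n.+2) : Prop := FlatSetting {
  fs_open : open Om;
  fs_convex : @convex_set R 'rV[R]_n.+2 Om;
  fs_continuous : {within closure Om, continuous u};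
  fs_convexf : @convex_function R 'rV[R]_n.+2 (closure Om) u;
  fs_lambda : 0 < lambda;
  fs_monge_ampere : forall A : set 'rV[R]_n.+2, borel A -> A `<=` Om ->
    (lambda%:E * lebesgue A <= monge_ampere Om u A)%E;
  fs_h : 0 < h;
  fs_slope : a 0 0 = 0;
  fs_slab : forall x : 'rV[R]_n.+2, 0 < x 0 0 -> `|x| < h -> Om x;
  fs_face : forall x : 'rV[R]_n.+2, x 0 0 = 0 -> `|x| < h -> closure Om x;
  fs_face_eq : forall x : 'rV[R]_n.+2, x 0 0 = 0 -> `|x| < h ->
    u x = dotv a x + c0;
  fs_slab_le : forall x : 'rV[R]_n.+2, 0 < x 0 0 -> `|x| < h ->
    u x <= dotv a x + c0 + C * x 0 0 }.

Section Estimates.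
Context {n : nat}.
Variables (Om : set 'rV[R]_n.+2) (u : 'rV[R]_n.+2 -> R) (lambda h C c0 : R)
  (a : 'rV[R]_n.+2).
Hypothesis S : flat_setting Om u lambda h C c0 a.
Let l (x : 'rV[R]_n.+2) : R := dotv a x + c0.
Let oOm := fs_open S.
Let cOm := fs_convex S.
Let ctu := fs_continuous S.
Let cvu := fs_convexf S.
Let MA := fs_monge_ampere S.
Let h0 := fs_h S.
Let a0 := fs_slope S.
Let slabOm := fs_slab S.
Let faceOm := fs_face S.
Let face := fs_face_eq S.
Let slab := fs_slab_le S.

(** One side of the box lies on the face, so the closed box is only known to lie in [closure Om];
    hence the separate sets [D] and [K] in [comparison]. *)
Lemma box_comparison (y : 'rV[R]_n.+2) r (P : 'rV[R]_n.+2 -> R)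
    (g : 'rV[R]_n.+2 -> 'rV[R]_n.+2) (kap : 'I_n.+2 -> R) (c : R) :
  (forall i, 0 < r i) -> y 0 0 = r 0 -> (forall x, cbox y r x -> `|x| < h) ->
  continuous P ->
  (forall y i s, P (y + s *: delta_mx 0 i) = P y + s * g y 0 i + s ^+ 2 * kap i) ->
  (forall U, open U -> (lebesgue (g @` U) <= c%:E * lebesgue U)%E) ->
  c < lambda ->
  (forall x, cbox y r x -> 0 <= x 0 0 -> `|x| < h ->
     (exists i, `|x 0 i - y 0 i| = r i) -> u x <= P x) ->
  u y <= P y.
Proof.
move=> r0 y0 rh cP Pg lg cl Pbd.
have K0 x : cbox y r x -> 0 <= x 0 0.
  by move=> /(_ 0); rewrite y0 ler_distl => /andP[]; rewrite subrr.
have DK : box y r `<=` cbox y r by move=> x Hx i; exact: ltW.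
apply: (comparison oOm cOm ctu cvu MA (open_box (y := y) (r := r)) _ DK _
   (compact_cbox (y := y) (r := r)) cP Pg lg cl).
- move=> x Hx; apply: slabOm; last exact/rh/DK.
  by have := Hx 0; rewrite y0 ltr_distl => /andP[]; rewrite subrr.
- move=> x Kx; have := K0 _ Kx; rewrite le_eqVlt => /predU1P[/esym x0|x0].
    by apply: faceOm => //; exact: rh.
  by apply: subset_closure; apply: slabOm => //; exact: rh.
- move=> x Kx nDx; apply: Pbd => //; [exact: K0|exact: rh|].
  have /existsNP[i /negP] := nDx; rewrite -leNgt => Hi; exists i.
  by apply/eqP; rewrite eq_le Hi Kx.
- by move=> i; rewrite subrr normr0.
Qed.

(** With half-sides r_i (y_1 for i = 0, otherwise w), the barrier adds sum_i gam (x_i - y_i)^2 /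
    r_i^2 to l + C x_1 - gam. On the boundary one summand equals gam, which restores the linear
    bound. The Hessian determinant is (2 gam)^n / prod_i r_i^2, and 4 w <= h keeps the box in the
    slab. *)
Lemma barrier (y : 'rV[R]_n.+2) (w gam : R) : 0 < y 0 0 <= w -> 4 * w <= h ->
  (forall i, i != 0 -> `|y 0 i| <= w) -> 0 < gam ->
  (2 * gam) ^+ n.+2 < lambda * y 0 0 ^+ 2 * (w ^+ 2) ^+ n.+1 ->
  u y <= l y + C * y 0 0 - gam.
Proof.
move=> /andP[y0 yw] wh yi gam0 gaml.
have w0 : 0 < w by exact: lt_le_trans yw.
pose r (i : 'I_n.+2) := if i == 0 then y 0 0 else w.
have r0 i : 0 < r i by rewrite /r; case: ifP.
have kap0 i : 0 < gam / r i ^+ 2 by rewrite divr_gt0// exprn_gt0.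
pose P (x : 'rV[R]_n.+2) := l x + C * x 0 0 - gam
  + \sum_i gam / r i ^+ 2 * (x 0 i - y 0 i) ^+ 2.
have Py : P y = l y + C * y 0 0 - gam.
  by rewrite /P big1 ?addr0// => i _; rewrite subrr expr0n /= mulr0.
rewrite -Py.
pose d i := a 0 i + C * (i == 0)%:R - 2 * (gam / r i ^+ 2) * y 0 i.
apply: (@box_comparison y r P (fun x => \row_i (2 * (gam / r i ^+ 2) * x 0 i + d i))
  (fun i => gam / r i ^+ 2) (\prod_i (2 * (gam / r i ^+ 2)))) => //.
- move=> x Kx; apply/(rV_norm_lt _ h0) => i; have := Kx i; rewrite /r.
  have [->|i0] := eqVneq i 0; first by rewrite ler_distl ltr_norml; lra.
  have := yi i i0; rewrite ler_distl ler_norml ltr_norml; lra.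
- move=> x; apply: (@continuousD _ _ _ (fun x => l x + C * x 0 0 - gam)
    (fun x : 'rV[R]_n.+2 => \sum_i gam / r i ^+ 2 * (x 0 i - y 0 i) ^+ 2)).
    apply: continuousB; last exact: cst_continuous.
    apply: continuousD; last first.
      by apply: continuousM; [exact: cst_continuous|exact: coord_continuous].
    by apply: continuousD; [exact: continuous_dotv|exact: cst_continuous].
  move: x; apply: continuous_big => [|i _ x]; first exact: (@add_continuous R).
  apply: (@continuousM _ 'rV[R]_n.+2 (fun=> _) (fun z : 'rV[R]_n.+2 => (z 0 i - y 0 i) ^+ 2)).
    exact: cst_continuous.
  apply: (@continuous_comp _ _ _ (fun z : 'rV[R]_n.+2 => z 0 i - y 0 i) (fun s => s ^+ 2)).
    by apply: continuousB; [exact: coord_continuous|exact: cst_continuous].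
  exact: exprn_continuous.
- move=> z i s; rewrite mxE /P /l dotvDr dotvZr dotv_delta !mxE /=.
  rewrite (bigD1 i)//= [in RHS](bigD1 i)//= !mxE !eqxx.
  rewrite (eq_bigr (fun j => gam / r j ^+ 2 * (z 0 j - y 0 j) ^+ 2)); last first.
    by move=> j ji; rewrite !mxE (negbTE ji) andbF mulr0 addr0.
  rewrite /d eq_sym mulr1n; ring.
- by move=> U oU; apply: scales_image_diag => // i; rewrite mulr_gt0.
- rewrite big_ord_recl /r /=.
  under eq_bigr do rewrite /=.
  rewrite prodr_const card_ord.
  rewrite !mulrA expr_div_n mulf_div -exprS.
  have den : 0 < y 0 0 ^+ 2 * (w ^+ 2) ^+ n.+1 by rewrite mulr_gt0 ?exprn_gt0.
  by rewrite ltr_pdivrMr// mulrA.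
- move=> x Kx x0 xh [i xi].
  have ub : u x <= l x + C * x 0 0.
    move: x0; rewrite le_eqVlt => /predU1P[/esym x0|x0]; last exact: slab.
    by rewrite face// x0 mulr0 addr0.
  suff : gam <= \sum_j gam / r j ^+ 2 * (x 0 j - y 0 j) ^+ 2 by rewrite /P; lra.
  rewrite (bigD1 i)//=.
  rewrite -[leLHS]addr0; apply: lerD; last first.
    by apply: sumr_ge0 => j _; rewrite mulr_ge0 ?sqr_ge0// ltW.
  by rewrite -(real_normK (num_real (x 0 i - y 0 i))) xi divfK// gt_eqF// exprn_gt0.
Qed.

(** On the segment from the face to height t, u is below its chord, while l is constant along e_1
    and equals u on the face; so a linear bound at height t passes to all lower heights. *)
Lemma ray (x : 'rV[R]_n.+2) (t B : R) : 0 < x 0 0 <= t ->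
  `|x + (t - x 0 0) *: delta_mx 0 0| < h ->
  u (x + (t - x 0 0) *: delta_mx 0 0) <= l x + B * t ->
  u x <= l x + B * x 0 0.
Proof.
move=> /andP[x0 xt]; set y := x + _ => yh uy.
have t0 : 0 < t by exact: lt_le_trans xt.
pose z := x - x 0 0 *: delta_mx 0 0.
have z0 : z 0 0 = 0 by rewrite !mxE eqxx mulr1 subrr.
have y0 : y 0 0 = t by rewrite !mxE eqxx mulr1 addrC subrK.
have zh : `|z| < h.
  apply/(rV_norm_lt _ h0) => i; have := (rV_norm_lt y h0).1 yh i; rewrite !mxE.
  have [->|i0] := eqVneq i 0; first by move=> _; rewrite /= mulr1 subrr normr0.
  by rewrite andbF !mulr0 addr0 subr0.
have lz : l z = l x by rewrite /l dotvDr dotvNr dotvZr dotv_delta a0 mulr0 subr0.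
have s01 : 0 <= x 0 0 / t <= 1.
  by rewrite divr_ge0 ?(ltW x0) ?(ltW t0)//= ler_pdivrMr// mul1r.
have Oy : closure Om y by apply/subset_closure/slabOm => //; rewrite y0.
have := convex_function_le cvu Oy (faceOm z0 zh) s01.
have -> : (x 0 0 / t) *: y + (1 - x 0 0 / t) *: z = x.
  apply/rowP => i; rewrite /y /z !mxE; field; exact: lt0r_neq0.
rewrite (face z0 zh) -/(l z) lz => /le_trans; apply.
have {}uy : x 0 0 / t * u y <= x 0 0 / t * (l x + B * t).
  by apply: ler_wpM2l => //; case/andP: s01.
apply: (le_trans (lerD uy (lexx _))).
rewrite le_eqVlt; apply/orP; left; apply/eqP; field; exact: lt0r_neq0.
Qed.

End Estimates.
End Barriers.

(** * The planar barrier *)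

Section Plane.
Context {R : realType}.
Variables (Om : set 'rV[R]_2) (u : 'rV[R]_2 -> R) (lambda h C c0 : R)
  (a : 'rV[R]_2).
Hypothesis S : flat_setting Om u lambda h C c0 a.
Let l (x : 'rV[R]_2) : R := dotv a x + c0.
Let i1 : 'I_2 := lift ord0 ord0.

Lemma ord2P (P : 'I_2 -> Prop) : P 0 -> P i1 -> forall i, P i.
Proof. by move=> P0 P1 i; case: (unliftP ord0 i) => [j ->|->] //; rewrite (ord1 j). Qed.

(** Let U be the bound assumed for u and z = x_2. Expanding U at y_2 = z, [P] replaces the factor
    y_1 of (y_2 - z)^2 by t and subtracts b y_1 (t - y_1). Hence P - U = (t - y_1)(M (y_2 - z)^2 /
    w^2 - b y_1), which vanishes at y_1 = t, while on the face P >= l = u. At the centre the gain is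
    b t^2 / 4, and b t >= lambda w^2 / (8 M). *)
Lemma plane_barrier (x : 'rV[R]_2) (t w M : R) : 0 < t <= w -> 4 * w <= h ->
  x 0 0 = t / 2 -> `|x 0 i1| < w -> 0 < M -> lambda * w ^+ 2 <= 8 * M ^+ 2 ->
  (forall y : 'rV[R]_2, 0 < y 0 0 <= t -> `|y| < h ->
    u y <= l y + C * y 0 0 - M * y 0 0 * (1 - (y 0 i1 / w) ^+ 2)) ->
  u x <= l x + C * x 0 0 - M * x 0 0 * (1 - (x 0 i1 / w) ^+ 2)
         - lambda * w ^+ 2 * t / (32 * M).
Proof.
move=> /andP[t0 tw] wh xt x1w M0 Mbig IH.
have w0 : 0 < w by exact: lt_le_trans tw.
have lam0 := fs_lambda S.
pose z := x 0 i1.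
have zw : z ^+ 2 < w ^+ 2 by rewrite -[z ^+ 2]real_normK ?num_real// ltr_pXn2r ?nnegrE// ltW.
(* With this b the Hessian [[2 b, be], [be, ga]] of P below has determinant lambda / 2. *)
pose b := (lambda / 2 + 4 * M ^+ 2 * z ^+ 2 / w ^+ 4) * w ^+ 2 / (4 * M * t).
have b0 : 0 < b.
  rewrite divr_gt0 ?mulr_gt0 ?exprn_gt0//.
  rewrite ltr_pwDl ?divr_gt0//.
  apply: divr_ge0; last by rewrite exprn_ge0// ltW.
  by rewrite -mulrA -exprMn mulr_ge0// sqr_ge0.
pose be := 2 * M * z / w ^+ 2.
pose ga := 2 * M * t / w ^+ 2.
have det : 2 * b * ga - be ^+ 2 = lambda / 2.
  rewrite /b /ga /be; field; rewrite !gt_eqF//.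
pose P (y : 'rV[R]_2) := l y + C * y 0 0 - M * y 0 0 * (1 - z ^+ 2 / w ^+ 2)
  + be * (y 0 0 * (y 0 i1 - z)) + ga / 2 * ((y 0 i1 - z) * (y 0 i1 - z))
  - b * (y 0 0 * (t - y 0 0)).
have bt : b * t = lambda * w ^+ 2 / (8 * M) + M * z ^+ 2 / w ^+ 2.
  by rewrite /b; field; rewrite !gt_eqF.
apply: (@le_trans _ _ (P x)); last first.
  have lbt : lambda * w ^+ 2 / (8 * M) <= b * t.
    rewrite bt lerDl; apply: divr_ge0; last exact: sqr_ge0.
    by apply: mulr_ge0; [exact: ltW|exact: sqr_ge0].
  have -> : lambda * w ^+ 2 * t / (32 * M) = lambda * w ^+ 2 / (8 * M) * (t / 4).
    by field; rewrite gt_eqF.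
  have -> : (x 0 i1 / w) ^+ 2 = z ^+ 2 / w ^+ 2 by rewrite expr_div_n.
  have : lambda * w ^+ 2 / (8 * M) * (t / 4) <= b * t * (t / 4).
    by apply: ler_wpM2r lbt; rewrite divr_ge0// ltW.
  rewrite /P xt -/z subrr; lra.
(* The half-width 3 w / 2 makes M (y_2 - z)^2 / w^2 = 9 M / 4 on the lateral sides, while [Mbig] and
   |z| < w give b t <= 2 M. *)
pose r (i : 'I_2) := if i == 0 then t / 2 else 3 / 2 * w.
pose d : 'rV[R]_2 := \row_i (if i == 0 then a 0 0 + C - M * (1 - z ^+ 2 / w ^+ 2)
   - be * z - b * t else a 0 i1 - ga * z).
apply: (@box_comparison _ _ _ _ _ _ _ _ _ S x r P
  (fun y => d + \row_i (if i == ord0 then 2 * b * y 0 0 + be * y 0 i1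
            else be * y 0 0 + ga * y 0 i1)) (fun i => if i == 0 then b else ga / 2)
  (2 * b * ga - be ^+ 2)).
- by apply: ord2P; rewrite /r /= ?divr_gt0 ?mulr_gt0// invr_gt0.
- by [].
- move=> y Ky; apply/(rV_norm_lt _ (fs_h S)); apply: ord2P.
    have := Ky 0; rewrite /r /= xt ler_distl ltr_norml; lra.
  have := Ky i1; rewrite /r /= -/z ler_distl ltr_norml.
  move: x1w; rewrite -/z ltr_norml; lra.
- have cc (k : R) : continuous (fun _ : 'rV[R]_2 => k) by move=> y; exact: cst_continuous.
  have cD (f g : 'rV[R]_2 -> R) : continuous f -> continuous g ->
    continuous (fun y => f y + g y) by move=> cf cg y; apply: continuousD; [exact: cf|exact: cg].
  have cB (f g : 'rV[R]_2 -> R) : continuous f -> continuous g ->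
    continuous (fun y => f y - g y) by move=> cf cg y; apply: continuousB; [exact: cf|exact: cg].
  have cM (f g : 'rV[R]_2 -> R) : continuous f -> continuous g ->
    continuous (fun y => f y * g y) by move=> cf cg y; apply: continuousM; [exact: cf|exact: cg].
  have cx i : continuous (fun y : 'rV[R]_2 => y 0 i) by exact: coord_continuous.
  have cl : continuous l by apply: cD => //; exact: continuous_dotv.
  rewrite /P; apply: (cB).
    apply: (cD).
      apply: (cD).
        apply: (cB); last by apply: (cM) => //; apply: (cM).
        by apply: (cD) => //; apply: (cM).
      by apply: (cM) => //; apply: (cM) => //; apply: (cB).
    by apply: (cM) => //; apply: (cM) => //; apply: (cB).
  by apply: (cM) => //; apply: (cM) => //; apply: (cB).
- move=> y i s; rewrite /P /l dotvDr dotvZr dotv_delta; move: i; apply: ord2P.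
    by rewrite !mxE /=; field; exact: lt0r_neq0.
  by rewrite !mxE /=; field; exact: lt0r_neq0.
- move=> U oU; apply: scales_image2 => //; rewrite ?det ?divr_gt0//.
  by rewrite mulr_gt0.
- rewrite det; lra.
- move=> y Ky y0 yh [i yi].
  have ga0 : 0 < ga by rewrite /ga divr_gt0 ?mulr_gt0 ?exprn_gt0.
  have yt : y 0 0 <= t.
    have := Ky 0; rewrite /r /= xt ler_distl; lra.
  move: y0; rewrite le_eqVlt => /predU1P[/esym y0|y0].
    rewrite (fs_face_eq S)// /P y0 /l.
    have : 0 <= ga / 2 * ((y 0 i1 - z) * (y 0 i1 - z)).
      by apply: mulr_ge0; [rewrite divr_ge0// ltW|rewrite -expr2 sqr_ge0].
    lra.
  apply: (le_trans (IH y _ yh)); first by rewrite y0.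
  rewrite -subr_ge0 (_ : _ - _ = (t - y 0 0) *
    (M * (y 0 i1 - z) ^+ 2 / w ^+ 2 - b * y 0 0)); last first.
    by rewrite /P /be /ga; field; rewrite gt_eqF.
  move: i yi; apply: ord2P => yi.
    have [] : y 0 0 = 0 \/ y 0 0 = t.
      move: yi; rewrite /r /= xt => /eqP; rewrite eqr_norml => /andP[/orP[]/eqP ? _];
      [right|left]; lra.
      by move=> y00; rewrite y00 ltxx in y0.
    by move=> ->; rewrite subrr mul0r.
  rewrite mulr_ge0 ?subr_ge0//.
  have -> : M * (y 0 i1 - z) ^+ 2 / w ^+ 2 = 9 / 4 * M.
    rewrite -[(_ - z) ^+ 2](real_normK (num_real _)) yi /r /=.
    by field; rewrite gt_eqF.
  have : b * y 0 0 <= b * t by rewrite ler_pM2l.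
  have : lambda * w ^+ 2 / (8 * M) <= M.
    by rewrite ler_pdivrMr ?mulr_gt0//; move: Mbig; rewrite expr2; lra.
  have : M * z ^+ 2 / w ^+ 2 <= M.
    by rewrite ler_pdivrMr ?exprn_gt0// ler_pM2l// ltW.
  rewrite bt; lra.
Qed.

(** Write M_k for the square root. M_0 comes from [barrier] at height w with gam = M_0 w, as (2
    gam)^2 = lambda w^4 / 2. Each halving of the height adds lambda w^2 / 8 to M_k^2; the gain found
    at the height w / 2^(k+1) spreads to lower points by [ray]. *)
Lemma plane_bound (w : R) k (x : 'rV[R]_2) : 0 < w -> 4 * w <= h ->
  0 < x 0 0 <= w / 2 ^+ k -> `|x| < h ->
  u x <= l x + C * x 0 0 -
    Num.sqrt (lambda * w ^+ 2 * k.+1%:R / 8) * x 0 0 * (1 - (x 0 i1 / w) ^+ 2).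
Proof.
move=> w0 wh; have lam0 := fs_lambda S.
pose M j : R := Num.sqrt (lambda * w ^+ 2 * j.+1%:R / 8).
have M2 j : M j ^+ 2 = lambda * w ^+ 2 * j.+1%:R / 8.
  by rewrite sqr_sqrtr// divr_ge0// !mulr_ge0 ?sqr_ge0// ltW.
have M0 j : 0 < M j by rewrite sqrtr_gt0 divr_gt0 ?mulr_gt0 ?exprn_gt0.
rewrite -/(M k).
(* For |y_2| >= w the factor 1 - (y_2 / w)^2 is not positive and the linear bound suffices. Such
   points matter because the boxes of [plane_barrier] reach beyond the strip |y_2| < w. *)
have wide j (y : 'rV[R]_2) : 0 < y 0 0 -> `|y| < h -> w <= `|y 0 i1| ->
    u y <= l y + C * y 0 0 - M j * y 0 0 * (1 - (y 0 i1 / w) ^+ 2).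
  move=> y0 yh yw; apply: (le_trans (fs_slab_le S y0 yh)); rewrite lerDl -mulrN.
  apply: mulr_ge0; first by rewrite mulr_ge0 ?ltW.
  rewrite opprB subr_ge0 expr_div_n.
  rewrite ler_pdivlMr ?exprn_gt0// mul1r -[leRHS]real_normK ?num_real//.
  by rewrite lerXn2r// nnegrE ltW.
have lift (y : 'rV[R]_2) t : 0 < y 0 0 <= t -> t <= w -> `|y 0 i1| < w ->
    `|y + (t - y 0 0) *: delta_mx 0 0| < h.
  move=> /andP[y0 yt] tw y1; apply/(rV_norm_lt _ (fs_h S)); apply: ord2P.
    by rewrite !mxE /= mulr1 addrC subrK ltr_norml; lra.
  by rewrite !mxE /= mulr0 addr0; lra.
have entries (y : 'rV[R]_2) t : (y + (t - y 0 0) *: delta_mx 0 0) 0 0 = t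
    /\ (y + (t - y 0 0) *: delta_mx 0 0) 0 i1 = y 0 i1
    /\ l (y + (t - y 0 0) *: delta_mx 0 0) = l y.
  rewrite !mxE /= mulr1 mulr0 addr0 addrC subrK; split => //; split => //.
  by rewrite /l dotvDr dotvZr dotv_delta (fs_slope S) mulr0 addr0.
elim: k x => [|k IH] x.
  rewrite expr0 divr1 => /andP[x0 xw] xh.
  have [x1|x1] := leP w `|x 0 i1|; first exact: wide.
  have /= xwh := lift x w _ (lexx _) x1; rewrite x0 in xwh.
  have {}xwh := xwh xw.
  have [y0 [y1 yl]] := entries x w.
  set y := x + _ in xwh y0 y1 yl.
  have : u y <= l x + (C - M 0) * w.
    have := @barrier _ _ _ _ _ _ _ _ _ S y w (M 0 * w).
    rewrite y0 -/(l y) yl => H.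
    apply: (le_trans (H _ _ _ _ _)) => //; last by lra.
    - by rewrite w0 lexx.
    - by apply: ord2P => // _; rewrite y1 ltW.
    - by rewrite mulr_gt0.
    - rewrite !exprMn M2 expr1 mulr1.
      have := mulr_gt0 lam0 (exprn_gt0 4 w0); lra.
  move=> /(ray S _ xwh) H; apply: (le_trans (H _)); first by rewrite x0.
  have : 0 <= M 0 * x 0 0 * (x 0 i1 / w) ^+ 2.
    by rewrite mulr_ge0 ?sqr_ge0// mulr_ge0 ?ltW.
  rewrite -/(l x); lra.
move=> /andP[x0 xw] xh.
have [x1|x1] := leP w `|x 0 i1|; first exact: wide.
pose t := w / 2 ^+ k.
have t0 : 0 < t by rewrite divr_gt0// exprn_gt0.
have tE : w / 2 ^+ k.+1 = t / 2 by rewrite /t exprS invfM mulrA mulrAC.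
rewrite tE in xw.
have tw : t <= w.
  rewrite /t ler_pdivrMr ?exprn_gt0//; apply: ler_peMr; first exact: ltW.
  by rewrite exprn_ege1// ler1n.
have [y0 [y1 yl]] := entries x (t / 2).
have yh := lift x (t / 2); rewrite x0 xw in yh.
have {}yh : `|x + (t / 2 - x 0 0) *: delta_mx 0 0| < h by apply: yh => //; lra.
set y := x + _ in y0 y1 yl yh.
have := @plane_barrier y t w (M k).
rewrite y0 y1 yl t0 tw => H.
have {}H := H isT wh erefl x1 (M0 k).
pose ph := 1 - (x 0 i1 / w) ^+ 2.
have : u y <= l x + (C - M k.+1 * ph) * (t / 2).
  apply: (le_trans (H _ _)) => //.
    rewrite M2; have := mulr_gt0 lam0 (exprn_gt0 2 w0) => lw.
    have : 1 <= k.+1%:R :> R by rewrite ler1n.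
    rewrite -(ler_pM2l lw); lra.
  rewrite -/ph.
  have ph1 : ph <= 1 by rewrite /ph gerBl sqr_ge0.
  have Mk : M k <= M k.+1.
    rewrite ler_wsqrtr// ler_pM2r ?invr_gt0// ler_pM2l ?mulr_gt0 ?exprn_gt0//.
    by rewrite ler_nat.
  (* From 2 M_k (M_(k+1) - M_k) <= M_(k+1)^2 - M_k^2 = lambda w^2 / 8. *)
  have dM : M k.+1 - M k <= lambda * w ^+ 2 / (16 * M k).
    rewrite ler_pdivlMr ?mulr_gt0//.
    have := M2 k.+1; have := M2 k; rewrite -[k.+2]addn1 natrD => e1 e2.
    have := sqr_ge0 (M k.+1 - M k); rewrite sqrrB e1 e2; lra.
  have : (M k.+1 - M k) * ph <= lambda * w ^+ 2 / (16 * M k).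
    apply: le_trans dM; apply: ler_piMr => //; lra.
  have -> : lambda * w ^+ 2 * t / (32 * M k) = lambda * w ^+ 2 / (16 * M k) * (t / 2).
    by field; rewrite gt_eqF.
  have t2 : 0 < t / 2 by rewrite divr_gt0.
  move=> /(ler_wpM2r (ltW t2)); lra.
move=> /(ray S _ yh) H'; apply: (le_trans (H' _)); first by rewrite x0.
by rewrite -/(l x) -/ph; lra.
Qed.

End Plane.

(** * Growth at the face *)

Section Growth.
Context {R : realType}.

(** Chosen so that gam = growth_const n * lambda^(1/n) r^2 s^(2/n) satisfies (2 gam)^n = lambda s^2
    r^(2n) / 2; the factor 1/2 provides the strict inequality that [barrier] demands. *)
Definition growth_const (n : nat) : R := (2^-1 ^+ n.+1) `^ (n%:R^-1).

Lemma growth_const_gt0 n : 0 < growth_const n.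
Proof. by rewrite powR_gt0// exprn_gt0. Qed.

Lemma small_powR (th e : R) : 0 < th -> 0 < e ->
  exists2 s0, 0 < s0 < 1 & forall s, 0 <= s <= s0 -> s `^ th < e.
Proof.
move=> th0 e0.
pose s1 := (e / 2) `^ th^-1.
have s10 : 0 < s1 by rewrite powR_gt0// divr_gt0.
exists (Num.min 2^-1 s1).
  by rewrite lt_min s10 invr_gt0 ltr0n /= gt_min invf_lt1// ltr1n.
move=> s /andP[s0]; rewrite le_min => /andP[_ ss1].
apply: (@le_lt_trans _ _ (s1 `^ th)).
  by apply: ge0_ler_powR; rewrite ?nnegrE// ltW.
rewrite /s1 -powRrM mulVf ?gt_eqF// powRr1 ?divr_ge0 ?ltW//.
by rewrite ltr_pdivrMr// ltr_pMr// ltr1n.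
Qed.

(** The right side serves Hoelder bounds through s^al and Lipschitz bounds through s. One s is
    enough to refute either of them. *)
Lemma growth_dominates n (al K : R) : (2 <= n)%N -> 2 / n%:R < al ->
  exists2 s, 0 < s < 1 & K * (s `^ al + s) < growth n s.
Proof.
move=> n2 nal; rewrite /growth; case: eqVneq => [n2'|n2'].
  rewrite n2' divff// in nal.
  (* Here al > 1, so both terms are at most s. At s = exp(- N) the root is (1/2 + N)^(1/2), which
     exceeds 2 |K|. *)
  pose N : R := 4 * K ^+ 2 + 1.
  have N0 : 0 < N by rewrite ltr_wpDl// mulr_ge0// sqr_ge0.
  exists (expR (- N)).
    by rewrite expR_gt0 expR_lt1 oppr_lt0.
  rewrite expRK opprK; set s := expR _.
  have s0 : 0 < s by exact: expR_gt0.
  have s1 : s <= 1 by rewrite expR_le1 oppr_le0 ltW.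
  have sal : s `^ al <= s by apply: ge1r_powR; rewrite ?s0//= ltW.
  have K2 : 2 * `|K| < Num.sqrt (2^-1 + N).
    rewrite -[ltLHS]ger0_norm ?mulr_ge0// -sqrtr_sqr ltr_sqrt; last first.
      by rewrite addr_gt0.
    by rewrite exprMn real_normK ?num_real// /N; lra.
  have : K * (s `^ al + s) <= `|K| * (2 * s).
    apply: (le_trans (ler_norm _)); rewrite normrM ler_wpM2l//.
    rewrite ger0_norm; [lra|by rewrite addr_ge0 ?powR_ge0// ltW].
  by move=> /le_lt_trans; apply; rewrite mulrA mulrC ltr_pM2l// mulrC.
have n3 : (2 < n)%N by rewrite ltn_neqAle eq_sym n2'.
have n0 : 0 < n%:R :> R by rewrite ltr0n (leq_trans _ n2).
(* Both s^al and s are at most s^be for s < 1, and be > 2/n since n >= 3. *)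
pose be := Num.min al 1.
have th0 : 0 < be - 2 / n%:R.
  by rewrite subr_gt0 lt_min nal /= ltr_pdivrMr// mul1r ltr_nat.
have e0 : 0 < (2 * `|K| + 1)^-1 by rewrite invr_gt0 ltr_wpDl// mulr_ge0.
have [s /andP[s0 s1] small] := small_powR th0 e0.
exists s; first by rewrite s0.
have {small} small : s `^ (be - 2 / n%:R) * (2 * `|K| + 1) < 1.
  rewrite -ltr_pdivlMr; last by rewrite ltr_wpDl// mulr_ge0.
  by rewrite div1r; apply: small; rewrite (ltW s0) lexx.
have p0 : 0 < s `^ (2 / n%:R) by rewrite powR_gt0.
have eb : s `^ be = s `^ (be - 2 / n%:R) * s `^ (2 / n%:R).
  by rewrite -powRD ?subrK// (gt_eqF s0) implybT.
have b1 : s `^ al <= s `^ be by apply: ger_powR; rewrite ?s0 ?(ltW s1)// /be ge_min lexx.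
have b2 : s <= s `^ be.
  by apply: ger1_powR; rewrite ?s0 ?(ltW s1)// /be ge_min lexx orbT.
have : K * (s `^ al + s) <= `|K| * (2 * s `^ be).
  apply: (le_trans (ler_norm _)); rewrite normrM ler_wpM2l//.
  rewrite ger0_norm; [lra|by rewrite addr_ge0 ?powR_ge0// ltW].
move=> /le_lt_trans; apply; rewrite eb -[ltRHS]mul1r !mulrA ltr_pM2r//.
by apply: le_lt_trans small; have := powR_ge0 s (be - 2 / n%:R); lra.
Qed.

End Growth.

Section GrowthBound.
Context {R : realType}.

(** Let w = h / 4 and let k be the integer part of - ln (x_1 / w). Then 2^k <= e^k <= w / x_1, so
    [plane_bound] applies with this k. As |x_2| < w / 2, the factor 1 - (x_2 / w)^2 is at least 3/4;
    after squaring, what remains is 1/2 - ln s <= 9/4 (k + 1). *)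
Lemma growth_bound2 (Om : set 'rV[R]_2) (u : 'rV[R]_2 -> R) (lambda h C c0 : R)
    (a : 'rV[R]_2) (S : flat_setting Om u lambda h C c0 a) (x : 'rV[R]_2) :
  0 < x 0 0 -> `|x| < h / 8 ->
  u x <= dotv a x + c0 + C * x 0 0 -
    growth_const 2 * lambda `^ (2%:R^-1) * (h / 8) ^+ 2
    * growth 2 (x 0 0 / (h / 8)).
Proof.
have lam0 := fs_lambda S; have h0 := fs_h S.
set r := h / 8; have rE : r = h / 8 by [].
have r0 : 0 < r by rewrite divr_gt0.
clearbody r.
move=> x0 xr; have xi := (rV_norm_lt x r0).1 xr.
have x0r : x 0 0 < r by apply: le_lt_trans (xi 0); exact: ler_norm.
pose w := h / 4; have w0 : 0 < w by rewrite divr_gt0.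
have wr : w = 2 * r by rewrite /w; lra.
have xw : x 0 0 < w by lra.
have wh : 4 * w <= h by rewrite /w; lra.
have xh : `|x| < h by lra.
set i1 : 'I_2 := lift ord0 ord0.
have x1 : (x 0 i1 / w) ^+ 2 <= 1 / 4.
  have hi : (x 0 i1 / w) ^+ 2 <= (1 / 2) ^+ 2.
    rewrite -[leLHS](real_normK (num_real _)) normrM normfV (ger0_norm (ltW w0)).
    apply: lerXn2r; rewrite ?nnegrE.
      by apply: divr_ge0 => //; exact: ltW.
      by [].
    rewrite ler_pdivrMr//.
    by apply: ltW; apply: lt_le_trans (xi i1) _; rewrite wr mulrA divfK ?mul1r.
  by apply: le_trans hi _; rewrite expr_div_n expr1n ler_pM2l// lef_pV2 ?posrE -?natrX ?ler_nat.
pose L := - ln (x 0 0 / w).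
have xw0 : 0 < x 0 0 / w by rewrite divr_gt0.
have L0 : 0 <= L by rewrite oppr_ge0 ln_le0// ler_pdivrMr// mul1r ltW.
have [k /andP[kL Lk]] : exists k : nat, k%:R <= L < k.+1%:R.
  by exists (Num.truncn L); exact: truncn_itv.
have xk : x 0 0 <= w / 2 ^+ k.
  rewrite ler_pdivlMr ?exprn_gt0// mulrC -ler_pdivlMr//.
  have -> : w / x 0 0 = expR L by rewrite expRN lnK ?posrE// invf_div.
  apply: (@le_trans _ _ (expR k%:R)); last by rewrite ler_expR.
  rewrite -[k%:R]mulr1 expRM_natl lerXn2r ?nnegrE ?expR_ge0//.
  by have := expR_ge1Dx (1 : R); lra.
have xk' : 0 < x 0 0 <= w / 2 ^+ k by rewrite x0.
apply: (le_trans (plane_bound S w0 wh xk' xh)).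
set Mk := Num.sqrt _.
rewrite lerD2l lerN2 /growth eqxx /growth_const !powR12_sqrt ?exprn_ge0 ?(ltW lam0)//.
set s := x 0 0 / r; set T := 2^-1 - ln s.
have s0 : 0 < s by rewrite divr_gt0.
have sw : x 0 0 / w <= s by rewrite ler_pM2l// lef_pV2 ?posrE//; lra.
have lns : - ln s <= L by rewrite lerN2 ler_ln ?posrE.
have T0 : 0 <= T.
  have : ln s <= 0 by rewrite ln_le0// ler_pdivrMr// mul1r ltW.
  rewrite /T; lra.
have Tk : T <= 9 / 4 * k.+1%:R.
  have : 1 <= k.+1%:R :> R by rewrite ler1n.
  rewrite /T; lra.
have Mk2 : Mk ^+ 2 = lambda * w ^+ 2 * k.+1%:R / 8.
  by rewrite sqr_sqrtr// divr_ge0// !mulr_ge0 ?sqr_ge0// ltW.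
have Mk0 : 0 <= Mk by exact: sqrtr_ge0.
pose G := Num.sqrt (2^-1 ^+ 3) * Num.sqrt lambda * r * Num.sqrt T.
have -> : Num.sqrt (2^-1 ^+ 3) * Num.sqrt lambda * r ^+ 2 * (s * Num.sqrt T)
    = x 0 0 * G.
  by rewrite /G /s; field; rewrite gt_eqF.
have G0 : 0 <= G by rewrite !mulr_ge0 ?sqrtr_ge0// ltW.
have GM : G <= 3 / 4 * Mk.
  rewrite -(@ler_pXn2r _ 2)// ?nnegrE ?mulr_ge0//.
  rewrite /G !exprMn Mk2 !sqr_sqrtr ?exprn_ge0 ?(ltW lam0)//.
  have lr : 0 < lambda * r ^+ 2 by rewrite mulr_gt0 ?exprn_gt0.
  by have := Tk; rewrite -(ler_pM2l lr) wr; lra.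
apply: (@le_trans _ _ (x 0 0 * (3 / 4 * Mk))); first by rewrite ler_pM2l.
rewrite [leRHS](_ : _ = x 0 0 * ((1 - (x 0 i1 / w) ^+ 2) * Mk)); last by ring.
by rewrite ler_pM2l// ler_wpM2r//; lra.
Qed.

Lemma growth_bound m (Om : set 'rV[R]_m.+2) (u : 'rV[R]_m.+2 -> R) (lambda h C c0 : R)
    (a : 'rV[R]_m.+2) (S : flat_setting Om u lambda h C c0 a) (x : 'rV[R]_m.+2) :
  0 < x 0 0 -> `|x| < h / 8 ->
  u x <= dotv a x + c0 + C * x 0 0 -
    growth_const m.+2 * lambda `^ (m.+2%:R^-1) * (h / 8) ^+ 2
    * growth m.+2 (x 0 0 / (h / 8)).
Proof.
have [m0|m0] := eqVneq m 0%N.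
  move: Om u a S x; rewrite m0 => Om u a S x; exact: (growth_bound2 S).
have lam0 := fs_lambda S; have h0 := fs_h S.
set r := h / 8; have rE : r = h / 8 by [].
have r0 : 0 < r by rewrite divr_gt0.
clearbody r.
move=> x0 xr; have xi := (rV_norm_lt x r0).1 xr.
have x0r : x 0 0 < r by apply: le_lt_trans (xi 0); exact: ler_norm.
have n0 : 0 < m.+2%:R :> R by [].
rewrite /growth eqSS eqSS (negbTE m0).
  set gam := (X in _ - X).
  have gamE : (2 * gam) ^+ m.+2 = lambda / 2 * x 0 0 ^+ 2 * (r ^+ 2) ^+ m.+1.
    have pn (y : R) : 0 <= y -> (y `^ (m.+2%:R^-1)) ^+ m.+2 = y.
      by move=> y0; rewrite -powR_mulrn ?powR_ge0// -powRrM mulVf ?gt_eqF// powRr1.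
    have pn2 (y : R) : 0 <= y -> (y `^ (2 / m.+2%:R)) ^+ m.+2 = y ^+ 2.
      by move=> y0; rewrite powRrM pn ?powR_ge0// powR_mulrn.
    have s0 : 0 <= x 0 0 / r by rewrite divr_ge0// ltW.
    rewrite /gam -(divfK (lt0r_neq0 r0) (x 0 0)) [(_ / r * r) ^+ 2]exprMn.
    move: (r ^+ 2) => q.
    rewrite !exprMn pn ?exprn_ge0// (pn _ (ltW lam0)) mulfK ?gt_eqF// (pn2 _ s0).
    rewrite [q ^+ m.+2]exprS exprVn [2 ^+ m.+3]exprS.
    by field; rewrite gt_eqF//= expf_neq0.
  (* [gamE] gives half of the admissible value already for width r; the actual width h / 4 = 2 r
     only enlarges the bound. *)
  apply: (@barrier _ _ _ _ _ _ _ _ _ S _ (h / 4)) => //.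
  - rewrite x0 /=; lra.
  - lra.
  - move=> i _; apply: ltW; apply: lt_trans (xi i) _; lra.
  - rewrite /gam !mulr_gt0 ?powR_gt0 ?growth_const_gt0 ?exprn_gt0 ?divr_gt0//.
  - rewrite gamE.
    have h4 : h / 4 = 2 * r by lra.
    rewrite h4; apply: (@lt_le_trans _ _ (lambda * x 0 0 ^+ 2 * (r ^+ 2) ^+ m.+1)).
      rewrite -subr_gt0; set A := lambda * _ * _.
      have A0 : 0 < A by rewrite /A !mulr_gt0 ?exprn_gt0.
      by rewrite (_ : _ - _ = A / 2) ?divr_gt0// /A; field.
    rewrite ler_pM2l ?mulr_gt0 ?exprn_gt0// lerXn2r ?nnegrE ?sqr_ge0//.
    rewrite exprMn ler_peMl ?sqr_ge0//; lra.
Qed.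

End GrowthBound.

(** * Reduction to a slab *)

Section EuclideanNorm.
Context {R : realType}.

Lemma coord_le_enorm n (x : 'rV[R]_n) i : `|x 0 i| <= enorm x.
Proof.
rewrite -sqrtr_sqr ler_wsqrtr// /dotv (bigD1 i)//= expr2 lerDl.
by apply: sumr_ge0 => j _; rewrite -expr2 sqr_ge0.
Qed.

Lemma enorm_lt n (x : 'rV[R]_n) (h r : R) : 0 < h -> n.+1%:R * h <= r ->
  (forall i, `|x 0 i| < h) -> enorm x < r.
Proof.
move=> h0 nh xh.
have r0 : 0 < r by apply: lt_le_trans nh; rewrite mulr_gt0.
rewrite -[ltRHS](ger0_norm (ltW r0)) -sqrtr_sqr ltr_sqrt ?exprn_gt0//.
apply: (@lt_le_trans _ _ ((n.+1%:R * h) ^+ 2)); last first.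
  by apply: lerXn2r => //; rewrite nnegrE ?mulr_ge0// ltW.
apply: (@le_lt_trans _ _ (n%:R * h ^+ 2)).
  rewrite mulr_natl -[in leRHS](card_ord n) -sumr_const ler_sum// => i _.
  by rewrite -expr2 -(real_normK (num_real _)); apply: lerXn2r; rewrite ?nnegrE// ltW.
rewrite exprMn ltr_pM2r ?exprn_gt0// -natrX ltr_nat.
by rewrite expnS expn1 mulSn (leq_trans _ (leq_addr _ _)).
Qed.

Lemma enormZ n (x : 'rV[R]_n) (k : R) : enorm (k *: x) = `|k| * enorm x.
Proof.
rewrite /enorm -sqrtr_sqr -sqrtrM ?sqr_ge0//; congr Num.sqrt.
by rewrite /dotv mulr_sumr; apply: eq_bigr => i _; rewrite !mxE; ring.
Qed.

Lemma enorm_delta n i : enorm (delta_mx 0 i : 'rV[R]_n) = 1.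
Proof. by rewrite /enorm dotv_delta mxE !eqxx sqrtr1. Qed.

Lemma spectral_norm_scalar n (k : R) : 0 <= k ->
  spectral_norm (k%:M : 'M[R]_n.+1) = k.
Proof.
move=> k0; rewrite /spectral_norm; set A := (X in sup X).
have Ak : A k.
  exists (delta_mx 0 0); first by rewrite /= enorm_delta.
  by rewrite mul_mx_scalar enormZ enorm_delta mulr1 ger0_norm.
have ub : ubound A k.
  move=> _ [v /= v1 <-]; rewrite mul_mx_scalar enormZ ger0_norm//.
  by rewrite -[leRHS]mulr1 ler_wpM2l.
apply/eqP; rewrite eq_le; apply/andP; split.
  by apply: ge_sup => //; exists k.
by apply: ub_le_sup => //; exists k.
Qed.

End EuclideanNorm.

(** * The slab at the face and the linear bound on it *)

Section Setting.
Context {R : realType} {m : nat}.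
Variables (Om : set 'rV[R]_m.+2) (rho : R) (u : 'rV[R]_m.+2 -> R) (lambda : R).
Hypotheses (oOm : open Om) (bOm : bounded_set Om)
  (cOm : @convex_set R 'rV[R]_m.+2 Om) (rho0 : 0 < rho)
  (fOm : flat_ball rho `<=` closure Om) (hOm : closure Om `<=` half_space)
  (ctu : {within closure Om, continuous u})
  (cvu : @convex_function R 'rV[R]_m.+2 (closure Om) u)
  (lambda0 : 0 < lambda)
  (MA : forall A : set 'rV[R]_m.+2, borel A -> A `<=` Om ->
       (lambda%:E * lebesgue A <= monge_ampere Om u A)%E)
  (afu : affine_on (flat_ball rho) u).

Lemma flat_ball_sup_norm : exists2 h, 0 < h &
  forall x : 'rV[R]_m.+2, x 0 0 = 0 -> `|x| < h -> flat_ball rho x.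
Proof.
exists (rho / m.+2%:R); first by rewrite divr_gt0.
have h0 : 0 < rho / m.+2%:R by rewrite divr_gt0.
move=> x x0 /(rV_norm_lt _ h0) xh; split => //.
apply: (@enorm_lt _ _ _ (rho / m.+2%:R)) => //.
  by rewrite mulrC divfK// pnatr_eq0.
by move=> i; rewrite mxE.
Qed.

Lemma fst_gt0 x : Om x -> 0 < x 0 0.
Proof.
move=> Ox.
have [e /= e0 eO] : exists2 e, 0 < e & ball x e `<=` Om.
  by apply/nbhs_ballP; exact: oOm.
have : Om (x - (e / 2) *: delta_mx 0 0).
  apply: eO; rewrite -ball_normE /= opprB addrC subrK normrZ.
  apply: (@le_lt_trans _ _ `|e / 2|); last by rewrite ger0_norm ?divr_ge0 ?ltW//; lra.
  apply: ler_piMr => //.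
  exact: normr_delta_le.
move=> /(@subset_closure _ Om) /hOm; rewrite /half_space /fst_coord /= !mxE /=.
lra.
Qed.

(** Fix p in [Om]. A point x near 0 with x_1 > 0 is t p + (1 - t) q with t = x_1 / p_1 and q on the
    hyperplane x_1 = 0. For |x| < k one has t < 1/2 and |q| <= 2 k (1 + |p| / p_1) < h, so q lies in
    the flat ball and x in [Om]. *)
Lemma slab_exists : exists2 h, 0 < h &
  (forall x : 'rV[R]_m.+2, 0 < x 0 0 -> `|x| < h -> Om x) /\
  (forall x : 'rV[R]_m.+2, x 0 0 = 0 -> `|x| < h -> flat_ball rho x).
Proof.
have [h h0 Hh] := flat_ball_sup_norm.
have z0 : flat_ball rho (0 : 'rV[R]_m.+2) by apply: Hh; rewrite ?mxE ?normr0.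
have [p [Op _]] := fOm z0 (filterT : nbhs (0 : 'rV[R]_m.+2) setT).
have p0 := fst_gt0 Op.
pose D := 2 * (1 + `|p| / p 0 0) + 1.
have pp : 0 <= `|p| / p 0 0 by rewrite divr_ge0// ltW.
have D0 : 1 <= D by rewrite /D; lra.
pose k := Num.min (p 0 0 / 2) (h / D).
have k0 : 0 < k by rewrite lt_min !divr_gt0//; lra.
have kh : k <= h.
  rewrite /k ge_min; apply/orP; right.
  by rewrite ler_pdivrMr; [rewrite ler_peMr// ltW|lra].
exists k => //; split; last by move=> x x0 xk; apply: Hh => //; exact: lt_le_trans kh.
move=> x x0 xk.
have x0k : x 0 0 < k.
  by apply: le_lt_trans ((rV_norm_lt x k0).1 xk 0); exact: ler_norm.
have xp : x 0 0 < p 0 0 / 2 by apply: lt_le_trans x0k _; rewrite /k ge_min lexx.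
pose t := x 0 0 / p 0 0.
have t0 : 0 < t by rewrite divr_gt0.
have t2 : t < 1 / 2 by rewrite ltr_pdivrMr//; lra.
pose q := (1 - t)^-1 *: (x - t *: p).
have t1 : 0 < 1 - t by lra.
have -> : x = t *: p + (1 - t) *: q.
  by rewrite /q scalerA mulfV ?gt_eqF// scale1r addrCA subrr addr0.
apply: segment_in_interior => //; last by rewrite t0; lra.
apply: fOm; apply: Hh.
  by rewrite !mxE /t divfK ?subrr ?mulr0// gt_eqF.
rewrite normrZ ger0_norm ?invr_ge0 ?(ltW t1)// mulrC ltr_pdivrMr//.
apply: (le_lt_trans (ler_normB _ _)); rewrite normrZ ger0_norm ?(ltW t0)//.
have tp : t * `|p| <= k * (`|p| / p 0 0).
  rewrite /t mulrAC -mulrA ler_wpM2r// ltW//.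
have kD : k * D <= h.
  by rewrite -ler_pdivlMr ?(lt_le_trans _ D0)// /k ge_min lexx orbT.
have : h * (1 / 2) < h * (1 - t) by rewrite ltr_pM2l//; lra.
by move: kD; rewrite /D; lra.
Qed.

Lemma closure_norm_le : exists M, forall x, closure Om x -> `|x| <= M.
Proof.
have [M [_ HM]] := bOm; exists (M + 1) => x clx; rewrite leNgt; apply/negP => Mx.
have d0 : 0 < `|x| - (M + 1) by lra.
have [y [Oy /=]] := clx _ (nbhsx_ballx x _ d0).
rewrite -ball_normE /= => xy.
have yM : `|y| <= M + 1 by apply: (HM (M + 1)) => //; rewrite ltrDl.
by have := ler_normD (x - y) y; rewrite subrK; lra.
Qed.

(** sup |g| read off the graph of g, so that the constant C_(L,g) can be a function of that graph
    alone. *)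
Definition boundary_sup (G : set ('rV[R]_m.+2 * R)) : R := sup [set `|p.2| | p in G].

Lemma boundary_sup_ub x : boundary Om x -> `|u x| <= boundary_sup (graph_on (boundary Om) u).
Proof.
move=> bx; apply: ub_le_sup; last by exists (x, u x) => //; exists x.
have cc : compact (closure Om).
  apply: bounded_closed_compact; last exact: closed_closure.
  have [M HM] := closure_norm_le; exists M; split => [|k Mk y cy]; first exact: num_real.
  by apply: (le_trans (HM y cy)); exact: ltW.
have [M [_ HM]] := compact_bounded (continuous_compact ctu cc).
exists (`|M| + 1) => _ [_ [y [cy _] <-] <-] /=.
by apply: (HM (`|M| + 1)); [rewrite (le_lt_trans (ler_norm M))// ltrDl|exists y].
Qed.

(** Follow the ray in direction e_1 from the foot z of x to its last point y = z + T e_1 in the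
    closure. Both z and y are boundary points and T >= h, so convexity between them bounds the slope
    by 2 sup |g| / h. *)
Lemma slab_le (h : R) : 0 < h ->
  (forall x : 'rV[R]_m.+2, 0 < x 0 0 -> `|x| < h -> Om x) ->
  (forall x : 'rV[R]_m.+2, x 0 0 = 0 -> `|x| < h -> flat_ball rho x) ->
  forall x : 'rV[R]_m.+2, 0 < x 0 0 -> `|x| < h ->
  u x <= u (x - x 0 0 *: delta_mx 0 0) +
     2 * boundary_sup (graph_on (boundary Om) u) / h * x 0 0.
Proof.
move=> h0 slab face x x0 xh.
set B := boundary_sup _.
set z := x - _; pose e : 'rV[R]_m.+2 := delta_mx 0 0.
have z0 : z 0 0 = 0 by rewrite !mxE /= mulr1 subrr.
have zi i : i != 0 -> z 0 i = x 0 i by move=> i0; rewrite !mxE (negbTE i0) andbF mulr0 subr0.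
have ze s : (z + s *: e) 0 0 = s by rewrite !mxE /= mulr1 subrr add0r mulr1.
have zei s i : i != 0 -> (z + s *: e) 0 i = x 0 i.
  by move=> i0; rewrite mxE (zi i i0) !mxE (negbTE i0) andbF mulr0 addr0.
have xi := (rV_norm_lt x h0).1 xh.
have zh s : `|s| < h -> `|z + s *: e| < h.
  move=> sh; apply/(rV_norm_lt _ h0) => i.
  by have [->|i0] := eqVneq i 0; [rewrite ze|rewrite zei].
have clz : closure Om z.
  apply/fOm/face => //; have := zh 0; rewrite scale0r addr0; apply.
  by rewrite normr0.
pose E := [set s | closure Om (z + s *: e)].
have Eh s : 0 < s -> s < h -> E s.
  move=> s0 sh; apply: subset_closure; apply: slab; first by rewrite ze.
  by apply: zh; rewrite gtr0_norm.
have [M HM] := closure_norm_le.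
have supE : has_sup E.
  split; first by exists (h / 2); apply: Eh; lra.
  exists M => s Es; apply: le_trans (HM _ Es).
  have := ler_norm s; move=> /le_trans; apply; rewrite -{1}(ze s).
  rewrite [leRHS]/Num.Def.normr /= mx_normrE; apply/bigmax_geP; right => /=.
  by exists (0, 0).
pose T := sup E.
have ET s : E s -> s <= T by move=> Es; exact: (ub_le_sup supE.2).
have hT : h <= T.
  rewrite leNgt; apply/negP => Th.
  have T0 : h / 2 <= T by apply/ET/Eh; lra.
  have := ET ((T + h) / 2); rewrite leNgt => /(_ (Eh _ _ _))/negP; lra.
have T0 : 0 < T by lra.
have ed d : `|d *: e| <= `|d|.
  rewrite normrZ; apply: ler_piMr => //.
  exact: normr_delta_le.
set y := z + T *: e.
have cly : closure Om y.
  apply: (@closed_closure _ Om) => B' /nbhs_ballP[d /= d0 dB].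
  have [s Es Ts] := sup_adherent d0 supE.
  exists (z + s *: e); split => //; apply: dB.
  rewrite -ball_normE /= /y opprD addrACA subrr add0r -scalerBl.
  have sT := ET s Es; apply: (le_lt_trans (ed _)).
  by rewrite ger0_norm ?subr_ge0// ltrBlDr addrC -ltrBlDr.
have nOy : ~ Om y.
  move=> Oy.
  have [d /= d0 dO] : exists2 d, 0 < d & ball y d `<=` Om.
    by apply/nbhs_ballP; exact: oOm.
  have : E (T + d / 2).
    apply/subset_closure/dO; rewrite -ball_normE /= /y scalerDl opprD addrACA subrr add0r.
    rewrite opprD addrA subrr sub0r normrN.
    apply: (le_lt_trans (ed _)); rewrite ger0_norm ?divr_ge0 ?ltW//; lra.
  move/ET; lra.
have bdz : boundary Om z.
  by split => // /(@interior_subset _ Om) /fst_gt0; rewrite z0 ltxx.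
have bdy : boundary Om y.
  by split => // /(@interior_subset _ Om).
have t01 : 0 <= x 0 0 / T <= 1.
  rewrite divr_ge0 ?(ltW x0) ?(ltW T0)//= ler_pdivrMr// mul1r ltW//.
  by apply: lt_le_trans hT; apply: le_lt_trans (xi 0); exact: ler_norm.
have := convex_function_le cvu cly clz t01.
have -> : (x 0 0 / T) *: y + (1 - x 0 0 / T) *: z = x.
  by apply/rowP => i; rewrite /y /z !mxE; field; exact: lt0r_neq0.
move=> /le_trans; apply.
have := boundary_sup_ub bdz; have := boundary_sup_ub bdy; rewrite -/B => uy uz.
have {uy} uy : u y <= B by apply: le_trans uy; exact: ler_norm.
have {uz} uz : - u z <= B by apply: le_trans uz; rewrite -normrN; exact: ler_norm.
have B0 : 0 <= B by apply: le_trans (boundary_sup_ub bdz).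
have : x 0 0 / T * (u y - u z) <= x 0 0 / T * (2 * B).
  by apply: ler_wpM2l; [case/andP: t01|lra].
have : x 0 0 / T * (2 * B) <= x 0 0 / h * (2 * B).
  apply: ler_wpM2r; first by rewrite mulr_ge0.
  by rewrite ler_pM2l// lef_pV2 ?posrE.
lra.
Qed.

Lemma exists_flat_setting : exists h c0 (a : 'rV[R]_m.+2),
  flat_setting Om u lambda h (2 * boundary_sup (graph_on (boundary Om) u) / h) c0 a
  /\ (forall x : 'rV[R]_m.+2, x 0 0 = 0 -> `|x| < h -> flat_ball rho x).
Proof.
have [h h0 [slab face]] := slab_exists.
have [a [c0 Ha]] := afu.
(* The first entry of the slope is removed: x_1 = 0 on the face, so the values there are
   unchanged. *)
exists h, c0, (a - a 0 0 *: delta_mx 0 0).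
have dE x : dotv (a - a 0 0 *: delta_mx 0 0) x = dotv a x - a 0 0 * x 0 0.
  rewrite /dotv (bigD1 0)//= [in RHS](bigD1 0)//= !mxE /= mulr1 subrr mul0r add0r.
  rewrite addrAC subrr add0r; apply: eq_bigr => i i0.
  by rewrite !mxE (negbTE i0) andbF mulr0 subr0.
split; last by [].
split => //.
- by rewrite !mxE /= mulr1 subrr.
- by move=> x x0 xh; exact/fOm/face.
- by move=> x x0 xh; rewrite dE x0 mulr0 subr0; exact/Ha/face.
move=> x x0 xh; apply: (le_trans (slab_le h0 slab face x0 xh)).
rewrite lerD2r dE Ha ?dotvDr ?dotvNr ?dotvZr ?dotv_delta; last first.
  apply: face; first by rewrite !mxE /= mulr1 subrr.
  apply/(rV_norm_lt _ h0) => i; have xi := (rV_norm_lt x h0).1 xh i; rewrite !mxE.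
  have [->|i0] := eqVneq i 0; first by rewrite /= mulr1 subrr normr0.
  by rewrite andbF mulr0 subr0.
by rewrite [x 0 0 * _]mulrC.
Qed.

End Setting.

(** * One-sided derivatives along the first axis *)

Section Slopes.
Context {R : realType} {m : nat}.
Variables (Om : set 'rV[R]_m.+2) (u : 'rV[R]_m.+2 -> R) (lambda h C c0 : R)
  (a : 'rV[R]_m.+2).
Hypothesis S : flat_setting Om u lambda h C c0 a.
Let e : 'rV[R]_m.+2 := delta_mx 0 0.
Let f (x : 'rV[R]_m.+2) (s : R) : R := u (x + s *: e).

Definition slab_set : set 'rV[R]_m.+2 := [set x : 'rV[R]_m.+2 | 0 < x 0 0 /\ `|x| < h].
Local Notation Q := slab_set.

Lemma open_slab_set : open Q.
Proof.
have -> : Q = (fun x : 'rV[R]_m.+2 => x 0 0) @^-1` [set s | 0 < s] `&`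
  (fun x : 'rV[R]_m.+2 => `|x|) @^-1` [set s | s < h] by [].
apply: openI; apply: open_comp.
- by move=> x _; exact: coord_continuous.
- exact: open_gt.
- by move=> x _; exact: norm_continuous.
- exact: open_lt.
Qed.

Lemma slab_setOm x : Q x -> closure Om x.
Proof. by move=> [x0 xh]; apply: subset_closure; exact: (fs_slab S). Qed.

Lemma slope_le x s1 s2 s3 : closure Om (x + s1 *: e) -> closure Om (x + s3 *: e) ->
  s1 <= s2 <= s3 ->
  (s3 - s1) * f x s2 <= (s3 - s2) * f x s1 + (s2 - s1) * f x s3.
Proof.
move=> O1 O3 /andP[s12 s23].
have [s13|] := ltP s1 s3; last first.
  move=> s31; have E1 : s2 = s1 by apply/eqP; rewrite eq_le s12 andbT; exact: le_trans s31.
  have E3 : s3 = s1 by apply/eqP; rewrite eq_le s31 -E1.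
  by rewrite E1 E3 subrr !mul0r addr0.
have d0 : 0 < s3 - s1 by rewrite subr_gt0.
pose t := (s3 - s2) / (s3 - s1).
have t01 : 0 <= t <= 1.
  apply/andP; split; first by rewrite divr_ge0 ?subr_ge0 ?(ltW s13).
  by rewrite ler_pdivrMr// mul1r lerD2l lerN2.
have := convex_function_le (fs_convexf S) O1 O3 t01.
have -> : t *: (x + s1 *: e) + (1 - t) *: (x + s3 *: e) = x + s2 *: e.
  apply/rowP => i; rewrite /t !mxE; field; exact: lt0r_neq0.
move=> H; have := ler_wpM2l (ltW d0) H.
rewrite -/(f x s2) -/(f x s1) -/(f x s3) => /le_trans; apply.
rewrite le_eqVlt; apply/orP; left; apply/eqP.
by rewrite /t; field; exact: lt0r_neq0.
Qed.

Lemma slope_mono x s1 s2 s3 s4 : s1 < s2 -> s3 < s4 -> s1 <= s3 -> s2 <= s4 ->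
  closure Om (x + s1 *: e) -> closure Om (x + s2 *: e) ->
  closure Om (x + s3 *: e) -> closure Om (x + s4 *: e) ->
  (f x s2 - f x s1) / (s2 - s1) <= (f x s4 - f x s3) / (s4 - s3).
Proof.
move=> s12 s34 s13 s24 O1 O2 O3 O4.
have s14 : s1 < s4 by exact: lt_le_trans s24.
apply: (@le_trans _ _ ((f x s4 - f x s1) / (s4 - s1))).
  rewrite ler_pdivrMr ?subr_gt0// mulrAC ler_pdivlMr ?subr_gt0//.
  have := @slope_le x s1 s2 s4 O1 O4; rewrite (ltW s12) s24 => /(_ isT); lra.
rewrite ler_pdivrMr ?subr_gt0// mulrAC ler_pdivlMr ?subr_gt0//.
have := @slope_le x s1 s3 s4 O1 O4; rewrite (ltW s34) s13 => /(_ isT); lra.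
Qed.

(** The right minus the left difference quotient with step d. By convexity it decreases, as d tends
    to 0, to the jump of the one-sided derivatives. *)
Definition jump (d : R) x := (f x d + f x (- d) - 2 * f x 0) / d.

(* The points of the slab where the one-sided derivatives along e differ: the second
   difference quotients do not tend to 0. By convexity each line parallel to e
   contains countably many of them. *)
Definition bad_set : set 'rV[R]_m.+2 := [set x : 'rV[R]_m.+2 | Q x /\ exists j : nat, forall k : nat,
  let d := k.+1%:R^-1 in Q (x + d *: e) -> Q (x + (- d) *: e) ->
  j.+1%:R^-1 <= jump d x].

Lemma continuous_slab x : Q x -> {for x, continuous u}.
Proof.
move=> [x0 xh]; apply: (continuous_in_open (fs_open S) (fs_continuous S)).
exact: (fs_slab S).
Qed.

(** Only the steps 1/(k+1) and thresholds 1/(j+1) occur, and for each pair the failure of the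
    inequality is an open condition by continuity of u in the slab. *)
Lemma measurable_bad_set : measurable (@row_of_tuple R _ @^-1` bad_set).
Proof.
pose U (j k : nat) := [set x : 'rV[R]_m.+2 | Q x /\ (Q (x + (k.+1%:R^-1 : R) *: e) /\
   (Q (x + (- (k.+1%:R^-1 : R)) *: e) /\ jump k.+1%:R^-1 x < j.+1%:R^-1))].
have -> : bad_set = \bigcup_j \bigcap_k (Q `\` U j k).
  apply/seteqP; split => [x [Qx [j Hj]]|x [j _ Hj]].
    exists j => // k _; split => // -[_ [Q1 [Q2]]]; rewrite ltNge => /negP; apply.
    exact: Hj.
  split; first by have [] := Hj 0%N I.
  exists j => k d Q1 Q2; have [Qx nU] := Hj k I.
  by rewrite leNgt; apply/negP => jd; apply: nU.
rewrite preimage_bigcup; apply: bigcupT_measurable => j.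
rewrite preimage_bigcap; apply: bigcapT_measurable => k.
rewrite -[_ @^-1` _]/((@row_of_tuple R _ @^-1` Q) `\` (@row_of_tuple R _ @^-1` U j k)).
apply: measurableD; apply: open_measurable_row.
  exact: open_slab_set.
rewrite openE => x [Qx [Q1 [Q2 Hx]]]; rewrite /interior.
have cs (s : R) : continuous (fun x : 'rV[R]_m.+2 => x + s *: e) by exact: continuous_translation.
have oQ s : Q (x + s *: e) -> nbhs x [set y | Q (y + s *: e)].
  by move=> Qs; apply: (cs s x Q); apply: open_nbhs_nbhs; split => //; exact: open_slab_set.
have cf s : Q (x + s *: e) -> {for x, continuous (f ^~ s)}.
  move=> Qs; apply: (@continuous_comp _ _ _ (fun x : 'rV[R]_m.+2 => x + s *: e) u).
    exact: cs.
  exact: continuous_slab.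
have cj : {for x, continuous (jump k.+1%:R^-1)}.
  apply: continuousM; last exact: cst_continuous.
  apply: continuousB; last first.
    apply: continuousM; first exact: cst_continuous.
    by apply: cf; rewrite scale0r addr0.
  by apply: continuousD; apply: cf.
apply: filterI; first by apply: open_nbhs_nbhs; split => //; exact: open_slab_set.
apply: filterI; first exact: oQ.
apply: filterI; first exact: oQ.
by apply: (cj [set s | s < j.+1%:R^-1]); apply: open_nbhs_nbhs; split => //; exact: open_lt.
Qed.

Lemma slab_set_between x s1 s2 s3 : Q (x + s1 *: e) -> Q (x + s3 *: e) ->
  s1 <= s2 <= s3 -> Q (x + s2 *: e).
Proof.
move=> [p1 n1] [p3 n3] /andP[s12 s23].
have E s : (x + s *: e) 0 0 = x 0 0 + s by rewrite !mxE /= mulr1.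
rewrite E in p1; rewrite E in p3.
split; first by rewrite E; lra.
apply/(rV_norm_lt _ (fs_h S)) => i.
have := (rV_norm_lt _ (fs_h S)).1 n3 i.
have [->|i0] := eqVneq i 0; last by rewrite !mxE (negbTE i0) andbF !mulr0.
rewrite !E (gtr0_norm p3) => ph; rewrite gtr0_norm; lra.
Qed.

Lemma left_le_right x s s' : Q x -> 0 < s -> Q (x + (- s) *: e) ->
  0 < s' -> Q (x + s' *: e) ->
  (f x 0 - f x (- s)) / s <= (f x s' - f x 0) / s'.
Proof.
move=> Qx s0 Qs s0' Qs'.
have Q0 : closure Om (x + 0 *: e) by rewrite scale0r addr0; exact: slab_setOm.
have := @slope_mono x (- s) 0 0 s' _ s0' _ (ltW s0') (slab_setOm Qs) Q0 Q0 (slab_setOm Qs').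
by rewrite oppr_lt0 oppr_le0 !subr0 sub0r opprK => H; apply: H => //; exact: ltW.
Qed.

Definition left_slopes x := [set (f x 0 - f x (- s)) / s | s in
  [set s | 0 < s /\ Q (x + (- s) *: e)]].

Lemma left_slopes_neq0 x : Q x -> left_slopes x !=set0.
Proof.
move=> [x0 xh]; exists ((f x 0 - f x (- (x 0 0 / 2))) / (x 0 0 / 2)).
exists (x 0 0 / 2) => //=; split; first by rewrite divr_gt0.
split; first by rewrite !mxE /= mulr1; lra.
apply/(rV_norm_lt _ (fs_h S)) => i; have := (rV_norm_lt _ (fs_h S)).1 xh i.
have [->|i0] := eqVneq i 0; last by rewrite !mxE (negbTE i0) andbF !mulr0 addr0.
by rewrite !mxE /= mulr1 gtr0_norm// => ph; rewrite gtr0_norm; lra.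
Qed.

Lemma right_exists x : Q x -> exists2 s, 0 < s & Q (x + s *: e).
Proof.
move=> [x0 xh]; have xi := (rV_norm_lt _ (fs_h S)).1 xh.
have x0h : x 0 0 < h by apply: le_lt_trans (xi 0); exact: ler_norm.
exists ((h - x 0 0) / 2); first by rewrite divr_gt0// subr_gt0.
have E : (x + ((h - x 0 0) / 2) *: e) 0 0 = (h + x 0 0) / 2.
  by rewrite !mxE /= mulr1; field.
split; first by rewrite E; have := fs_h S; lra.
apply/(rV_norm_lt _ (fs_h S)) => i; have := xi i.
have [->|i0] := eqVneq i 0; last by rewrite !mxE (negbTE i0) andbF !mulr0 addr0.
by rewrite E => _; rewrite gtr0_norm; have := fs_h S; lra.
Qed.

Lemma left_le_sup x s : Q x -> 0 < s -> Q (x + (- s) *: e) ->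
  (f x 0 - f x (- s)) / s <= sup (left_slopes x).
Proof.
move=> Qx s0 Qs; apply: ub_le_sup; last by exists s.
have [d d0 Qd] := right_exists Qx.
by exists ((f x d - f x 0) / d) => _ [t [t0 Qt] <-]; exact: left_le_right.
Qed.

(** [L], the supremum of the left slopes, is below every right slope. Off the bad set some step dk
    has left and right slopes less than eps apart; by monotonicity they enclose L and all quotients
    with |s| < dk, so the derivative exists and equals L. *)
Lemma derive_le x d : Q x -> ~ bad_set x -> 0 < d -> Q (x + d *: e) ->
  'D_e u x <= (f x d - f x 0) / d.
Proof.
move=> Qx nbad d0 Qd; pose L := sup (left_slopes x).
have Lright s : 0 < s -> Q (x + s *: e) -> L <= (f x s - f x 0) / s.
  move=> s0 Qs; apply: ge_sup; first exact: left_slopes_neq0.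
  by move=> _ [t [t0 Qt] <-]; exact: left_le_right.
have Lleft s : 0 < s -> Q (x + (- s) *: e) -> (f x 0 - f x (- s)) / s <= L.
  exact: left_le_sup.
suff -> : 'D_e u x = L by exact: Lright.
rewrite /derive; apply: cvg_lim => //; apply/cvgrPdist_lt => eps eps0.
have [j] := ltr_add_invr eps0; rewrite add0r => jeps.
have [k [Qk [Qk' Jk]]] : exists k, let d := k.+1%:R^-1 in
    Q (x + d *: e) /\ Q (x + (- d) *: e) /\ jump d x < j.+1%:R^-1.
  apply: contrapT => H; apply: nbad; split => //; exists j => k d' Q1 Q2.
  by rewrite leNgt; apply/negP => J; apply: H; exists k.
rewrite /= in Qk Qk' Jk; set dk := k.+1%:R^-1 in Qk Qk' Jk.
have dk0 : 0 < dk by rewrite invr_gt0.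
have Qx0 : Q (x + 0 *: e) by rewrite scale0r addr0.
have Jk' : (f x dk - f x 0) / dk - (f x 0 - f x (- dk)) / dk < eps.
  by apply: lt_trans jeps; apply: le_lt_trans Jk; rewrite /jump; lra.
rewrite near_withinE; apply/nbhs_ballP; exists dk => // s.
rewrite -ball_normE /= sub0r normrN => sdk s0.
have -> : s^-1 *: (u (s *: e + x) - u x) = (f x s - f x 0) / s.
  by rewrite /f scale0r addr0 [x + _]addrC mulrC.
have [sp|sn|/eqP] := ltgtP s 0; last by rewrite (negbTE s0).
- have ns0 : 0 < - s by rewrite oppr_gt0.
  rewrite ltr0_norm// in sdk.
  have Qs : Q (x + s *: e).
    by apply: (slab_set_between Qk' Qx0); apply/andP; split; lra.
  have -> : (f x s - f x 0) / s = (f x 0 - f x (- - s)) / - s.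
    by rewrite opprK invrN mulrN -mulNr opprB.
  have h1 := Lleft (- s) ns0; rewrite opprK in h1; have {}h1 := h1 Qs.
  have h2 := Lright _ dk0 Qk.
  have h3 := @slope_mono x (- dk) 0 s 0 _ sp _ (lexx _) (slab_setOm Qk')
     (slab_setOm Qx0) (slab_setOm Qs) (slab_setOm Qx0).
  rewrite oppr_lt0 dk0 !sub0r opprK in h3.
  have {}h3 := h3 isT; rewrite lerNl (ltW sdk) in h3; have {}h3 := h3 isT.
  rewrite opprK ltr_norml; apply/andP; split; lra.
- rewrite gtr0_norm// in sdk.
  have Qs : Q (x + s *: e) by apply: (slab_set_between Qx0 Qk); apply/andP; split; lra.
  have h1 := Lright _ sn Qs; have h2 := Lleft _ dk0 Qk'.
  have h3 := @slope_mono x 0 s 0 dk sn dk0 (lexx _) (ltW sdk) (slab_setOm Qx0)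
     (slab_setOm Qs) (slab_setOm Qx0) (slab_setOm Qk).
  rewrite !subr0 in h3.
  rewrite ltr_norml; apply/andP; split; lra.
Qed.

(** The gap 1/(j+1), known for small symmetric steps, passes to all left and right slopes by
    monotonicity. The rational number will label the point in a countability argument. *)
Lemma bad_separation x : bad_set x -> exists q : rat,
  (forall s, 0 < s -> Q (x + (- s) *: e) -> (f x 0 - f x (- s)) / s < ratr q) /\
  (forall s, 0 < s -> Q (x + s *: e) -> ratr q < (f x s - f x 0) / s).
Proof.
move=> [Qx [j Hj]].
have gap s s' : 0 < s -> Q (x + (- s) *: e) -> 0 < s' -> Q (x + s' *: e) ->
    (f x 0 - f x (- s)) / s + j.+1%:R^-1 <= (f x s' - f x 0) / s'.
  move=> s0 Qs s0' Qs'.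
  have m0 : 0 < Num.min s s' by rewrite lt_min s0.
  have [k] := ltr_add_invr m0; rewrite add0r lt_min => /andP[ks ks'].
  set d : R := k.+1%:R^-1 in ks ks'.
  have d0 : 0 < d by rewrite invr_gt0.
  have Qx0 : Q (x + 0 *: e) by rewrite scale0r addr0.
  have Qd : Q (x + d *: e) by apply: (slab_set_between Qx0 Qs'); apply/andP; split; lra.
  have Qd' : Q (x + (- d) *: e).
    by apply: (slab_set_between Qs Qx0); apply/andP; split; lra.
  have J : j.+1%:R^-1 <= (f x d + f x (- d) - 2 * f x 0) / d := Hj k Qd Qd'.
  have h1 := @slope_mono x 0 d 0 s' d0 s0' (lexx _) (ltW ks') (slab_setOm Qx0)
     (slab_setOm Qd) (slab_setOm Qx0) (slab_setOm Qs').
  have h2 := @slope_mono x (- s) 0 (- d) 0 _ _ _ (lexx _) (slab_setOm Qs)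
     (slab_setOm Qx0) (slab_setOm Qd') (slab_setOm Qx0).
  rewrite !subr0 in h1.
  rewrite !oppr_lt0 lerN2 !sub0r !opprK in h2; have {}h2 := h2 s0 d0 (ltW ks).
  clearbody d; move: (j.+1%:R^-1) J => c J; lra.
have Lt : sup (left_slopes x) < sup (left_slopes x) + j.+1%:R^-1.
  by rewrite ltrDl invr_gt0.
have [q] := rat_in_itvoo Lt; rewrite in_itv /= => /andP[q1 q2].
exists q; split => s s0 Qs; last first.
  apply: (lt_le_trans q2); rewrite -lerBrDr; apply: ge_sup.
    exact: left_slopes_neq0.
  by move=> _ [t [t0 Qt] <-]; rewrite lerBrDr; exact: gap.
by apply: le_lt_trans q1; exact: left_le_sup.
Qed.

(** By Fubini it suffices to count on each line parallel to e_1. For bad t1 < t2 the chord between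
    them is a right slope at t1 and a left slope at t2, so its slope separates the rational labels:
    they increase strictly with t. *)
Lemma null_bad_set :
  lebesgue_tuple m.+2 (@row_of_tuple R _ @^-1` bad_set) = 0%E.
Proof.
rewrite lebesgue_tupleSE product_measure12 /product_measure2; last first.
  by apply: measurable_preimage_cons; exact: measurable_bad_set.
rewrite (eq_integral (fun=> 0%E)); first exact: integral0.
move=> y _ /=; apply: countable_lebesgue_measure0.
pose X (t : R) : 'rV[R]_m.+2 := row_of_tuple (tuple_of_cons (t : measurableTypeR R, y)).
have XE t t' : X t' = X t + (t' - t) *: e.
  apply/rowP => i; rewrite !mxE; case: (unliftP 0 i) => [j ->|->].
    by rewrite !tnthS andbF mulr0 addr0.
  by rewrite /= mulr1 addrC subrK.
rewrite (_ : ysection _ _ = [set t | bad_set (X t)]); last first.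
  by apply/seteqP; split => t; rewrite /ysection /= inE.
have ex t : exists q : rat, bad_set (X t) ->
  (forall s, 0 < s -> Q (X t + (- s) *: e) -> (f (X t) 0 - f (X t) (- s)) / s < ratr q) /\
  (forall s, 0 < s -> Q (X t + s *: e) -> ratr q < (f (X t) s - f (X t) 0) / s).
  have [Bt|nBt] := pselect (bad_set (X t)); last by exists 0.
  by have [q ?] := bad_separation Bt; exists q.
have [q Hq] := choice ex.
apply/countable_injP; exists (pickle \o q).
have key t1 t2 : bad_set (X t1) -> bad_set (X t2) -> t1 < t2 -> (q t1 < q t2)%R.
  move=> B1 B2 t12; have d0 : 0 < t2 - t1 by rewrite subr_gt0.
  have [_ H1] := Hq _ B1; have [H2 _] := Hq _ B2.
  have [[Q1 _] [Q2 _]] := (B1, B2).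
  have := H1 _ d0; have := H2 _ d0; rewrite /f scaleNr !scale0r !addr0.
  rewrite (_ : X t2 - _ = X t1); last by rewrite (XE t1 t2) addrK.
  rewrite -(XE t1 t2) => /(_ Q1) h1 /(_ Q2) h2.
  by rewrite -(ltr_rat R); exact: lt_trans h1.
move=> t1 t2 /[!inE] B1 B2 /(pcan_inj pickleK) q12.
have [t12|t21|//] := ltgtP t1 t2.
- by have := key _ _ B1 B2 t12; rewrite q12 ltxx.
- by have := key _ _ B2 B1 t21; rewrite q12 ltxx.
Qed.

End Slopes.

(** * Steep chords and the unbounded gradient *)

Section Drop.
Context {R : realType} {m : nat}.
Variables (Om : set 'rV[R]_m.+2) (u : 'rV[R]_m.+2 -> R) (lambda h C c0 : R)
  (a : 'rV[R]_m.+2).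
Hypothesis S : flat_setting Om u lambda h C c0 a.
Let e : 'rV[R]_m.+2 := delta_mx 0 0.
Let f (x : 'rV[R]_m.+2) (s : R) : R := u (x + s *: e).
Local Notation Q := (slab_set h).
Let c := growth_const m.+2 * lambda `^ (m.+2%:R^-1) * (h / 8) ^+ 2.

Lemma drop_const_gt0 : 0 < c.
Proof.
rewrite /c mulr_gt0 ?mulr_gt0 ?growth_const_gt0 ?powR_gt0 ?exprn_gt0 ?divr_gt0//;
  by [exact: (fs_lambda S)|exact: (fs_h S)].
Qed.

Lemma face_shift (x : 'rV[R]_m.+2) s (d : R) : x 0 0 = 0 -> `|x| < d -> `|s| < d ->
  (x + s *: e) 0 0 = s /\ `|x + s *: e| < d.
Proof.
move=> x0 xd sd; have d0 : 0 < d by apply: le_lt_trans sd.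
have E : (x + s *: e) 0 0 = s by rewrite !mxE /= mulr1 x0 add0r.
split => //; apply/(rV_norm_lt _ d0) => i; have := (rV_norm_lt _ d0).1 xd i.
have [->|i0] := eqVneq i 0; first by rewrite E.
by rewrite !mxE (negbTE i0) andbF mulr0 addr0.
Qed.

Lemma growth_drop (x : 'rV[R]_m.+2) t : x 0 0 = 0 -> `|x| < h / 8 -> 0 < t < h / 8 ->
  c * growth m.+2 (t / (h / 8)) - C * t <= u x - f x t.
Proof.
move=> x0 xh /andP[t0 th].
have tn : `|t| < h / 8 by rewrite gtr0_norm.
have [E1 E2] := face_shift x0 xh tn.
have := growth_bound S (_ : 0 < (x + t *: e) 0 0) E2; rewrite E1 => /(_ t0).
rewrite dotvDr dotvZr dotv_delta (fs_slope S) mulr0 addr0 -/c -/(f x t).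
have xh' : `|x| < h by apply: lt_trans xh _; have := fs_h S; lra.
rewrite (fs_face_eq S x0 xh'); lra.
Qed.

Lemma face_continuous (x : 'rV[R]_m.+2) (eta : R) : x 0 0 = 0 -> `|x| < h -> 0 < eta ->
  exists2 d, 0 < d & forall s, 0 < s < d -> `|f x s - u x| < eta.
Proof.
move=> x0 xh eta0.
have h0 := fs_h S.
have cx := fs_face S x0 xh.
have : within (closure Om) (nbhs x) [set y | ball (u x) eta (u y)].
  rewrite nbhs_subspace_in//; have ct : {within closure Om, continuous u} := fs_continuous S.
  exact: (ct x _ (nbhsx_ballx (u x) _ eta0)).
rewrite /within /= => /nbhs_ballP[d /= d0 dB].
exists (Num.min d h); first by rewrite lt_min d0.
move=> s /andP[s0]; rewrite lt_min => /andP[sd sh].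
have sn : `|s| < h by rewrite gtr0_norm.
have [E1 E2] := face_shift x0 xh sn.
have Qs : Q (x + s *: e) by split => //; rewrite E1.
suff Bx : ball x d (x + s *: e).
  by have := dB _ Bx (slab_setOm S Qs); rewrite -ball_normE /= distrC.
rewrite -ball_normE /= opprD addrA subrr sub0r normrN normrZ (gtr0_norm s0).
apply: le_lt_trans sd; apply: ler_piMr; first exact: ltW.
exact: normr_delta_le.
Qed.

Lemma gradient_ge x d : Q x -> ~ bad_set u h x -> 0 < d -> Q (x + d *: e) ->
  (u x - f x d) / d <= enorm (gradient u x).
Proof.
move=> Qx nbx d0 Qd.
have := derive_le S Qx nbx d0 Qd; rewrite scale0r addr0 => D.
apply: le_trans (coord_le_enorm _ 0); rewrite mxE.
rewrite ler_normr; apply/orP; right.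
rewrite lerNr; apply: le_trans D _; rewrite -mulNr opprB.
exact: lexx.
Qed.

(** The chord from 0 to height t is as steep as desired by [growth_dominates]. Its lower end is on
    the face, outside the slab; continuity of u at the face allows moving it inside to height q, at
    a cost below eta. *)
Lemma steep_chord (M : R) : exists x d, [/\ Q x, 0 < d, Q (x + d *: e) &
  M < (u x - f x d) / d].
Proof.
have h0 := fs_h S; have r0 : 0 < h / 8 by rewrite divr_gt0.
have M0 : 0 <= `|M| by [].
have al : 2 / m.+2%:R < 2 :> R by rewrite ltr_pdivrMr// ltr_pMr// ltr1n.
have [s /andP[s0 s1]] :=
  @growth_dominates R m.+2 2 ((`|M| + `|C|) * (h / 8) / c) isT al.
set K := _ / c => Kg.
pose t := s * (h / 8).
have t0 : 0 < t by rewrite mulr_gt0.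
have th : t < h / 8 by rewrite gtr_pMl.
have z0 : (0 : 'rV[R]_m.+2) 0 0 = 0 by rewrite mxE.
have zh : `|0 : 'rV[R]_m.+2| < h / 8 by rewrite normr0.
have K0 : 0 <= K by apply: divr_ge0; [rewrite mulr_ge0 ?addr_ge0 ?(ltW r0)|exact: ltW drop_const_gt0].
have tr : t / (h / 8) = s by rewrite /t mulfK// gt_eqF.
have drop : `|M| * t < u 0 - f 0 t.
  have := @growth_drop 0 t z0 zh; rewrite t0 th => /(_ isT); rewrite tr.
  apply: lt_le_trans.
  have : K * s < growth m.+2 s.
    by apply: le_lt_trans Kg; rewrite ler_wpM2l// lerDr powR_ge0.
  have cK : c * (K * s) = (`|M| + `|C|) * t.
    have cn := lt0r_neq0 drop_const_gt0.
    by rewrite /K mulrA [c * _]mulrC divfK// /t; ring.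
  rewrite -(ltr_pM2l drop_const_gt0) cK => Kt.
  have : C * t <= `|C| * t by rewrite ler_pM2r// ler_norm.
  lra.
pose eta := u 0 - f 0 t - `|M| * t.
have eta0 : 0 < eta by rewrite /eta; lra.
have zh' : `|0 : 'rV[R]_m.+2| < h by rewrite normr0.
have [d d0 Hd] := face_continuous z0 zh' eta0.
pose q := Num.min (d / 2) (t / 2).
have q0 : 0 < q by rewrite lt_min !divr_gt0.
have qd : q < d by rewrite /q gt_min; apply/orP; left; lra.
have qt : q < t by rewrite /q gt_min; apply/orP; right; lra.
have qq : 0 < q < d by rewrite q0.
have := Hd q qq; rewrite ltr_distl => /andP[uq _].
have xd : 0 + q *: e + (t - q) *: e = 0 + t *: e :> 'rV[R]_m.+2.
  by rewrite -addrA -scalerDl subrKC.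
have face s' : 0 < s' -> s' < h -> Q (0 + s' *: e).
  move=> s'0 s'h; have s'n : `|s'| < h by rewrite gtr0_norm.
  by have [E1 E2] := face_shift z0 zh' s'n; split => //; rewrite E1.
exists (0 + q *: e), (t - q); split.
- by apply: face => //; lra.
- by rewrite subr_gt0.
- by rewrite xd; apply: face => //; lra.
rewrite ltr_pdivlMr ?subr_gt0//.
have -> : f (0 + q *: e) (t - q) = f 0 t by rewrite /f xd.
have h1 : M * (t - q) <= `|M| * (t - q) by rewrite ler_pM2r ?subr_gt0// ler_norm.
have h2 : `|M| * (t - q) <= `|M| * t by apply: ler_wpM2l => //; lra.
by move: uq; rewrite -/(f 0 q) /eta; lra.
Qed.

(** For fixed M the points with a chord steeper than M form a nonempty open set, which a null set
    together with the bad set cannot cover. *)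
Lemma gradient_Linfty :
  Lp_norm Om +oo%E (fun x => enorm (gradient u x)) = +oo%E.
Proof.
pose g := fun x => enorm (gradient u x).
have large (M : R) (Z : set (m.+2.-tuple (measurableTypeR R))) : measurable Z ->
    lebesgue_tuple m.+2 Z = 0%E ->
    ~ (forall t, ~ Z t -> (g \_ Om) (row_of_tuple t) <= M).
  move=> mZ Z0 HZ.
  pose U := [set x | exists2 d, 0 < d & [/\ Q x, Q (x + d *: e) & M < (u x - f x d) / d]].
  have oU : open U.
    rewrite openE => x [d d0 [Qx Qd Mx]]; rewrite /interior.
    have oQ := @open_slab_set R m h.
    have cs : continuous (fun x : 'rV[R]_m.+2 => x + d *: e) by exact: continuous_translation.
    have cj : {for x, continuous (fun x => (u x - f x d) / d)}.
      apply: continuousM; last exact: cst_continuous.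
      apply: continuousB; first exact: (continuous_slab S).
      apply: (@continuous_comp _ _ _ (fun x : 'rV[R]_m.+2 => x + d *: e) u); first exact: cs.
      exact: (continuous_slab S).
    have n1 : nbhs x Q by apply: open_nbhs_nbhs.
    have n2 : nbhs x [set y | Q (y + d *: e)].
      by apply: (cs x Q); apply: open_nbhs_nbhs.
    have n3 : nbhs x [set y | M < (u y - f y d) / d].
      by apply: (cj [set s | M < s]); apply: open_nbhs_nbhs; split => //; exact: open_gt.
    by apply: filterS (filterI n1 (filterI n2 n3)) => y [? [? ?]]; exists d.
  have [x [d [Qx d0 Qd Mx]]] := steep_chord M.
  have Ux : U x by exists d.
  have := lebesgue_open_gt0 oU Ux.
  rewrite lebesgue_measurableE; last exact: open_measurable_row.
  apply/negP; rewrite -leNgt.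
  pose N := @row_of_tuple R _ @^-1` bad_set u h.
  have mN : measurable N by exact: (measurable_bad_set S).
  have ZN : (lebesgue_tuple m.+2 (Z `|` N) <= 0)%E.
    rewrite (le_trans (measureU2 _ _ _))//= Z0 (null_bad_set S) adde0.
    exact: lexx.
  apply: le_trans ZN; apply: le_measure; rewrite ?inE.
  - exact: open_measurable_row.
  - exact: measurableU.
  - move=> t [k k0 [Qt Qk Mt]].
    have [Nt|Nt] := pselect (N t); [by right|left].
    apply: contrapT => /HZ; rewrite patchE ifT; last first.
      by rewrite inE; apply: (fs_slab S); case: Qt.
    by rewrite leNgt => /negP; apply; apply: lt_le_trans Mt _; exact: gradient_ge.
rewrite /Lp_norm unlock.
(* The norm with exponent +oo is an essential supremum only when the whole space has positive
   measure; [large] applied to the whole space excludes the other case. *)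
have muT : (0 < lebesgue_tuple m.+2 [set: m.+2.-tuple (measurableTypeR R)])%E.
  have := measure_ge0 (lebesgue_tuple m.+2) [set: m.+2.-tuple (measurableTypeR R)].
  rewrite le_eqVlt => /predU1P[T0|//].
  by exfalso; apply: (large 0 setT measurableT (esym T0)) => t; case.
rewrite muT; apply/eqP; rewrite -leye_eq leNgt; apply/negP => fin.
have [M EM] : exists M : R, (ess_sup (lebesgue_tuple m.+2) (abse \o
    (fun t => ((g \_ Om) (row_of_tuple t))%:E)) <= M%:E)%E.
  move: fin; case: (ess_sup _ _) => [r _| //|_]; first by exists r.
  by exists 0; rewrite leNye.
have /ess_supP [Z [mZ Z0 HZ]] := EM.
apply: (large M Z) => // t nZt; rewrite leNgt; apply/negP => Mt.
apply: nZt; apply: HZ => /=; rewrite lee_fin; apply/negP; rewrite -ltNge.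
by apply: lt_le_trans Mt _; exact: ler_norm.
Qed.

End Drop.

(** * The norms of the gradient *)

Section MeasureLemmas.
Import HBNNSimple.
Context {R : realType}.

(* The library's monotonicity lemmas assume measurability, which is not known
   here for the larger function. *)
Lemma ge0_le_integral_nonmeasurable d (T : measurableType d)
    (mu : {measure set T -> \bar R}) (F G : T -> \bar R) :
  (forall x, (0 <= F x)%E) -> (forall x, (F x <= G x)%E) ->
  (\int[mu]_x F x <= \int[mu]_x G x)%E.
Proof.
move=> F0 FG; rewrite !ge0_integralTE//; last by move=> x; exact: le_trans (FG x).
apply: ereal_sup_le => _ [k /= kF <-].
by exists k => //= x; exact: le_trans (FG x).
Qed.

Lemma nneseries_infinitely_often (v : nat -> \bar R) (ep : R) : 0 < ep ->
  (forall i, (0 <= v i)%E) ->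
  (forall k, exists2 i, (k <= i)%N & (ep%:E <= v i)%E) ->
  (\sum_(i <oo) v i = +oo)%E.
Proof.
move=> ep0 v0 often.
have part N : exists k, ((N%:R * ep)%:E <= \sum_(0 <= i < k) v i)%E.
  elim: N => [|N [k Hk]]; first by exists 0%N; rewrite mul0r big_geq.
  have [i ki Hi] := often k; exists i.+1.
  rewrite big_nat_recr//= -natr1 mulrDl mul1r EFinD; apply: leeD => //.
  apply: (le_trans Hk); rewrite [leRHS](big_cat_nat _ ki)//=.
  by rewrite leeDl// sume_ge0.
apply/eqyP => A A0.
pose N := Num.truncn (A / ep).
have [k Hk] := part N.+1; apply: le_trans (nneseries_lim_ge k _) => //.
apply: le_trans Hk; rewrite lee_fin -ler_pdivrMr// ltW//.
exact: truncnS_gt.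
Qed.

Lemma measurable_patch_row n (V : set 'rV[R]_n) (g : 'rV[R]_n -> R) : open V ->
  (forall x, V x -> {for x, continuous g}) ->
  measurable_fun setT (fun t : n.-tuple (measurableTypeR R) =>
    (g \_ V) (row_of_tuple t) : measurableTypeR R).
Proof.
move=> oV cg.
rewrite (_ : (fun t => _) =
   ((g \o @row_of_tuple R n) \_ (@row_of_tuple R n @^-1` V))); last first.
  by apply/funext => t; rewrite !patchE /=.
have mV := open_measurable_row oV.
apply/(measurable_restrictT _ mV).
apply: (measurability _ (RGenOInfty.measurableE R)) => _ [_ [s ->] <-].
rewrite (_ : _ `&` _ = @row_of_tuple R n @^-1` (V `&` [set x | s < g x])); last first.
  by apply/seteqP; split => t /=; rewrite in_itv /= andbT.
apply: open_measurable_row; rewrite openE => x [Vx sx]; rewrite /interior.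
apply: filterI; first exact: oV.
by apply: (cg x Vx [set y | s < y]); apply: open_nbhs_nbhs; split => //; exact: open_gt.
Qed.

End MeasureLemmas.

(** * Dyadic layers in dimension at least 3 *)

Section DyadicDrop.
Context {R : realType} {m : nat}.
Variables (Om : set 'rV[R]_m.+3) (u : 'rV[R]_m.+3 -> R) (lambda h C c0 : R)
  (a : 'rV[R]_m.+3).
Hypothesis S : flat_setting Om u lambda h C c0 a.
Let e : 'rV[R]_m.+3 := delta_mx 0 0.
Let f (x : 'rV[R]_m.+3) (s : R) : R := u (x + s *: e).
Local Notation Q := (slab_set h).
Let c := growth_const m.+3 * lambda `^ (m.+3%:R^-1) * (h / 8) ^+ 2.
Let r := h / 8.
Let th : R := 2 / m.+3%:R.
Let p : R := m.+3%:R / m.+1%:R.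

Let r0 : 0 < r. Proof. by rewrite divr_gt0//; exact: (fs_h S). Qed.
Let c_gt0 : 0 < c. Proof. exact: (drop_const_gt0 S). Qed.
Let th0 : 0 < th. Proof. by rewrite divr_gt0. Qed.
Let th1 : th < 1. Proof. by rewrite ltr_pdivrMr// mul1r ltr_nat. Qed.

(** Since 2/n < 1, the linear error C s r is at most half of c s^(2/n) for small s. *)
Lemma drop_lower : exists2 s0, 0 < s0 < 1 &
  forall (x : 'rV[R]_m.+3) s, x 0 0 = 0 -> `|x| < r -> 0 < s <= s0 ->
  c / 2 * s `^ th <= u x - f x (s * r).
Proof.
pose K := `|C| * r + 1.
have K0 : 0 < K by rewrite ltr_wpDl// mulr_ge0// ltW.
have [s0 s01 Hs] := @small_powR R (1 - th) (c / (2 * K))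
  (ltac:(by rewrite subr_gt0)) (ltac:(by rewrite divr_gt0// mulr_gt0)).
exists s0 => // x s x0 xr /andP[sp ss0].
have s1 : s < 1 by apply: le_lt_trans ss0 _; case/andP: s01.
have sr : 0 < s * r < r by rewrite mulr_gt0//= gtr_pMl.
have := growth_drop S x0 xr sr; rewrite /growth /= -/c -/r mulfK ?gt_eqF// -/th.
apply: le_trans.
have := Hs s; rewrite (ltW sp) ss0 => /(_ isT); rewrite ltr_pdivlMr ?mulr_gt0// => sm.
have st : 0 < s `^ th by rewrite powR_gt0.
have Es : s = s `^ (1 - th) * s `^ th.
  by rewrite -powRD ?subrK ?powRr1 ?(ltW sp)// (gt_eqF sp) implybT.
have : C * (s * r) <= K * s.
  rewrite mulrCA -[leRHS]mulrC ler_pM2l// /K.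
  have : C * r <= `|C| * r by rewrite ler_pM2r// ler_norm.
  lra.
rewrite {2}Es mulrA => h1.
have h2 : K * s `^ (1 - th) * s `^ th <= c / 2 * s `^ th.
  by rewrite ler_pM2r//; lra.
lra.
Qed.

Section Line.
Variables (s0 : R) (x : 'rV[R]_m.+3).
Hypotheses (s01 : 0 < s0 < 1) (x0 : x 0 0 = 0) (xr : `|x| < r)
  (low : forall s, 0 < s <= s0 -> c / 2 * s `^ th <= u x - f x (s * r)).
Let s i : R := s0 / 2 ^+ i.
(** [dyadic_rate] times s_i^th is the amount by which (c / 4) s^th falls from s_i to s_(i+1) = s_i /
    2. *)
Definition dyadic_rate : R := c / 4 * (1 - (2^-1) `^ th).

Lemma dyadic_rate_gt0 : 0 < dyadic_rate.
Proof.
have E : (1 : R) `^ th = 1 by rewrite powR1.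
rewrite mulr_gt0 ?divr_gt0// subr_gt0 -[ltRHS]E.
by apply: gt0_ltr_powR; rewrite ?nnegrE ?invr_ge0// invf_lt1// ltr1n.
Qed.

(* Otherwise u x - f x (s i * r) would stay above a positive constant as i grows,
   against the continuity of u at the face. *)
Lemma dyadic_drop k : exists2 i, (k <= i)%N &
  dyadic_rate * s i `^ th <= f x (s i.+1 * r) - f x (s i * r).
Proof.
have /andP[s00 s0lt] := s01.
have sp i : 0 < s i by rewrite divr_gt0// exprn_gt0.
have sS i : s i.+1 = 2^-1 * s i by rewrite /s exprS invfM mulrCA.
have sle i : s i <= s0.
  rewrite ler_pdivrMr ?exprn_gt0//; apply: ler_peMr; first exact: ltW.
  by rewrite exprn_ege1// ler1n.
apply: contrapT => H.
have {}H i : (k <= i)%N -> f x (s i.+1 * r) - f x (s i * r) < dyadic_rate * s i `^ th.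
  by move=> ki; rewrite ltNge; apply/negP => Hi; apply: H; exists i.
(* If all drops from k on are too small, E does not decrease from k on; E k > 0 because [low] holds
   with c / 2 in place of c / 4. *)
pose E i := u x - f x (s i * r) - c / 4 * s i `^ th.
have mono i : (k <= i)%N -> E i <= E i.+1.
  move=> /H; rewrite /E sS (powRM th _ (ltW (sp i))) ?invr_ge0// /dyadic_rate; lra.
have monoE i : (k <= i)%N -> E k <= E i.
  elim: i => [|i IH]; first by rewrite leqn0 => /eqP ->.
  rewrite leq_eqVlt => /predU1P[->//|]; rewrite ltnS => ki.
  exact: le_trans (IH ki) (mono _ ki).
have Ek : 0 < E k.
  have := @low (s k); rewrite sp sle => /(_ isT).
  have := powR_gt0 th (sp k) => P; have : 0 < c / 4 * s k `^ th by rewrite mulr_gt0// divr_gt0.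
  rewrite /E; lra.
have xh : `|x| < h by apply: lt_trans xr _; rewrite /r; have := fs_h S; lra.
have [d d0 Hd] := face_continuous S x0 xh Ek.
have dr0 : 0 < d / r by rewrite divr_gt0.
have [j Hj] := ltr_add_invr dr0; rewrite add0r in Hj.
have sj : s (maxn j k) < d / r.
  apply: le_lt_trans Hj.
  apply: (@le_trans _ _ (2 ^+ maxn j k)^-1).
    rewrite /s -[leRHS]mul1r ler_wpM2r ?invr_ge0 ?exprn_ge0// ltW//.
  rewrite lef_pV2 ?posrE ?exprn_gt0// -natrX ler_nat.
  by apply: leq_trans (ltn_expl _ _); rewrite // ltnS leq_maxl.
have sd : 0 < s (maxn j k) * r < d by rewrite mulr_gt0//= -ltr_pdivlMr.
have := Hd _ sd; rewrite ltr_distl => /andP[F1 _].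
have := monoE (maxn j k) (leq_maxr _ _); rewrite {2}/E.
have := powR_ge0 (s (maxn j k)) th => P.
have : 0 <= c / 4 * s (maxn j k) `^ th by rewrite mulr_ge0// divr_ge0// ltW.
by move: F1; rewrite -/(f x _); lra.
Qed.

(** The chord slope is at least (2 dyadic_rate / r) s_i^(th - 1), and (th - 1) p = -1 for p = n / (n
    - 2): the p-th power is of order 1 / s_i and cancels the thickness s_(i+2) r = s_i r / 4 of the
    layer. *)
Lemma dyadic_energy k : exists2 i, (k <= i)%N &
  (2 * dyadic_rate / r) `^ p * r / 4 <=
  s i.+2 * r * (Num.max ((f x (s i.+1 * r) - f x (s i * r)) / (s i.+1 * r)) 0) `^ p.
Proof.
have [i ki Hi] := dyadic_drop k; exists i => //.
have /andP[s00 s0lt] := s01.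
have sp j : 0 < s j by rewrite divr_gt0// exprn_gt0.
have sS j : s j.+1 = s j / 2 by rewrite /s exprS invfM mulrCA mulrC.
have D0 := dyadic_rate_gt0.
have p0 : 0 < p by rewrite divr_gt0.
have Hbig : 2 * dyadic_rate / r * s i `^ (th - 1) <=
    Num.max ((f x (s i.+1 * r) - f x (s i * r)) / (s i.+1 * r)) 0.
  rewrite le_max; apply/orP; left; rewrite ler_pdivlMr; last exact: mulr_gt0.
  apply: le_trans Hi; rewrite le_eqVlt; apply/orP; left; apply/eqP.
  have -> : s i `^ th = s i `^ (th - 1) * s i.
    by rewrite -{3}[s i]powRr1 ?(ltW (sp i))// -powRD ?subrK// (gt_eqF (sp i)) implybT.
  by rewrite sS; field; rewrite (lt0r_neq0 r0).
have lhs0 : 0 <= 2 * dyadic_rate / r * s i `^ (th - 1).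
  by rewrite mulr_ge0 ?powR_ge0// divr_ge0 ?(ltW r0)// mulr_ge0// ltW.
set B := Num.max _ _ in Hbig *.
have : (2 * dyadic_rate / r * s i `^ (th - 1)) `^ p <= B `^ p.
  by apply: ge0_ler_powR => //; rewrite ?nnegrE ?(le_trans lhs0 Hbig)// ltW.
rewrite powRM ?powR_ge0//; last by rewrite divr_ge0 ?(ltW r0)// mulr_ge0// ltW.
rewrite -powRrM (_ : (th - 1) * p = -1); last first.
  have nE : m.+3%:R = m.+1%:R + 2 :> R by rewrite -natrD addn2.
  have k0 : 0 < m.+1%:R :> R by [].
  rewrite /th /p nE; move: (m.+1%:R) k0 => q q0.
  by field; rewrite !lt0r_neq0// addr_gt0.
rewrite powR_inv1 ?(ltW (sp i))// => H.
have sr0 : 0 < s i.+2 * r by exact: mulr_gt0.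
have := ler_wpM2l (ltW sr0) H; apply: le_trans.
rewrite le_eqVlt; apply/orP; left; apply/eqP.
by rewrite !sS; field; exact: lt0r_neq0 (sp i).
Qed.

End Line.

End DyadicDrop.

(** * Divergence of the integral of the p-th power of the gradient *)

Section GradientLp.
Context {R : realType} {m : nat}.
Variables (Om : set 'rV[R]_m.+3) (u : 'rV[R]_m.+3 -> R) (lambda h C c0 : R)
  (a : 'rV[R]_m.+3).
Hypothesis S : flat_setting Om u lambda h C c0 a.
Local Notation mR := (measurableTypeR R).
Let e : 'rV[R]_m.+3 := delta_mx 0 0.
Let f (x : 'rV[R]_m.+3) (s : R) : R := u (x + s *: e).
Local Notation Q := (slab_set h).
Let r := h / 8.
Let p : R := m.+3%:R / m.+1%:R.
Let r0 : 0 < r. Proof. by rewrite divr_gt0//; exact: (fs_h S). Qed.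
Let rh : r < h. Proof. by rewrite /r; have := fs_h S; lra. Qed.
Let p0 : 0 < p. Proof. by rewrite divr_gt0. Qed.

Definition to_face (x : 'rV[R]_m.+3) : 'rV[R]_m.+3 := x - x 0 0 *: e.

Lemma to_face0 x : to_face x 0 0 = 0.
Proof. by rewrite !mxE /= mulr1 subrr. Qed.

Lemma to_faceE x i : i != 0 -> to_face x 0 i = x 0 i.
Proof. by move=> i0; rewrite !mxE (negbTE i0) andbF mulr0 subr0. Qed.

Lemma to_faceK x s : to_face x + s *: e = x + (s - x 0 0) *: e.
Proof. by rewrite /to_face scalerBl addrAC addrA. Qed.

Lemma norm_to_face x : `|to_face x| <= `|x|.
Proof.
rewrite [leLHS]/Num.Def.normr /= mx_normrE; apply/bigmax_leP; split => // -[j i] _ /=.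
rewrite (ord1 j); have [->|i0] := eqVneq i 0; first by rewrite to_face0 normr0.
rewrite to_faceE// [leRHS]/Num.Def.normr /= mx_normrE.
by apply/bigmax_geP; right => /=; exists (0, i).
Qed.

Lemma continuous_to_face : continuous to_face.
Proof.
move=> x B /nbhs_ballP[d /= d0 dB]; apply/nbhs_ballP; exists d => // z.
rewrite -!ball_normE /= => xz; apply: dB; rewrite -ball_normE /=.
have -> : to_face x - to_face z = to_face (x - z).
  by apply/rowP => i; rewrite /to_face !mxE; ring.
exact: le_lt_trans (norm_to_face _) xz.
Qed.

Let V : set 'rV[R]_m.+3 := [set x | `|to_face x| < r].

Let oV : open V.
Proof.
rewrite (_ : V = to_face @^-1` ((fun x : 'rV[R]_m.+3 => `|x|) @^-1` [set s | s < r]))//.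
apply: open_comp; first by move=> x _; exact: continuous_to_face.
by apply: open_comp; [move=> x _; exact: norm_continuous|exact: open_lt].
Qed.

Section Layers.
Variable s0 : R.
Hypotheses (s01 : 0 < s0 < 1) (low : forall (x : 'rV[R]_m.+3) s, x 0 0 = 0 ->
  `|x| < r -> 0 < s <= s0 ->
  growth_const m.+3 * lambda `^ (m.+3%:R^-1) * (h / 8) ^+ 2 / 2 * s `^ (2 / m.+3%:R)
    <= u x - u (x + (s * r) *: e)).

Let t (i : nat) : R := s0 / 2 ^+ i * r.

Lemma layer_gt0 i : 0 < t i.
Proof. by have /andP[? _] := s01; apply: mulr_gt0 => //; rewrite divr_gt0// exprn_gt0. Qed.

Lemma layerS i : t i = 2 * t i.+1.
Proof. by rewrite /t exprS invfM; field; rewrite expf_neq0. Qed.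

Lemma layer_lt i : t i < r.
Proof.
have /andP[s00 s0lt] := s01; rewrite gtr_pMl// ltr_pdivrMr ?exprn_gt0// mul1r.
by apply: lt_le_trans s0lt _; rewrite exprn_ege1// ler1n.
Qed.

Lemma layer_slab x s : V x -> 0 < s < r -> Q (to_face x + s *: e).
Proof.
move=> Vx /andP[sp sr].
have sn : `|s| < r by rewrite gtr0_norm.
have [E1 E2] := face_shift (to_face0 x) Vx sn.
by split; [rewrite E1|exact: lt_trans rh].
Qed.

Definition chord_slope i (x : 'rV[R]_m.+3) : R :=
  (f (to_face x) (t i.+1) - f (to_face x) (t i)) / t i.+1.

(* By convexity, the gradient at a point with t_(i+2) <= x_1 < t_(i+1) is at least the
   chord slope between t_(i+1) and t_i, which does not depend on x_1. *)
Definition layer_fun i (v : m.+3.-tuple mR) : \bar R :=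
  (\1_(`[t i.+2, t i.+1[%classic : set R) (thead v)
   * (Num.max ((chord_slope i \_ V) (row_of_tuple v)) 0) `^ p)%:E.

Lemma layer_fun_ge0 i v : (0 <= layer_fun i v)%E.
Proof. by rewrite lee_fin mulr_ge0// powR_ge0. Qed.

Lemma measurable_layer_fun i : measurable_fun setT (layer_fun i).
Proof.
apply/measurable_EFinP; apply: measurable_funM.
  apply: (@measurableT_comp _ _ _ _ _ _ (\1_(`[t i.+2, t i.+1[%classic : set R) : mR -> mR)
    _ (fun v : m.+3.-tuple mR => thead v : mR)).
    exact: measurable_indic.
  exact: (@measurable_tnth _ mR m.+3 ord0).
apply: (@measurableT_comp _ _ _ _ _ _ (fun s : mR => (s `^ p : mR))).
  exact: measurable_powR.
apply: measurable_maxr => //.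
apply: (measurable_patch_row oV) => x Vx.
have cf j : {for x, continuous (fun x => f (to_face x) (t j))}.
  apply: (@continuous_comp _ _ _ (fun x : 'rV[R]_m.+3 => to_face x + t j *: e) u).
    have cs : continuous (fun y : 'rV[R]_m.+3 => y + t j *: e) by exact: continuous_translation.
    by apply: (@continuous_comp _ _ _ to_face (fun y : 'rV[R]_m.+3 => y + t j *: e)); [exact: continuous_to_face|exact: cs].
  by apply: (continuous_slab S); apply: layer_slab => //; rewrite layer_gt0 layer_lt.
apply: continuousM; last exact: cst_continuous.
by apply: continuousB; exact: cf.
Qed.

Lemma layer_fun_le i v : ~ bad_set u h (row_of_tuple v) ->
  (layer_fun i v <= (((fun x => enorm (gradient u x)) \_ Om) (row_of_tuple v) `^ p)%:E)%E.
Proof.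
set x := row_of_tuple v => nbx.
rewrite lee_fin indicE.
have [|_] := boolP (_ \in _); last by rewrite mul0r powR_ge0.
rewrite inE /= in_itv /= mul1r.
have -> : thead v = x 0 0 by rewrite mxE.
move=> /andP[lo hi].
apply: ge0_ler_powR; rewrite ?nnegrE ?le_max ?lexx ?orbT//; first exact: ltW.
  by rewrite patchE; case: ifP => // _; exact: sqrtr_ge0.
have g0 : 0 <= ((fun x => enorm (gradient u x)) \_ Om) x.
  by rewrite patchE; case: ifP => // _; exact: sqrtr_ge0.
rewrite ge_max g0 andbT patchE; case: ifPn => // /[!inE] Vx.
have x0 : 0 < x 0 0 by apply: lt_le_trans lo; exact: layer_gt0.
have xE : x = to_face x + x 0 0 *: e by rewrite to_faceK subrr scale0r addr0.
have Qx : Q x.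
  by rewrite xE; apply: layer_slab => //; rewrite x0 (lt_trans hi)// layer_lt.
rewrite patchE ifT; last by rewrite inE; apply: (fs_slab S); case: Qx.
have ti : t i = 2 * t i.+1 by exact: layerS.
have tp := layer_gt0 i.+1.
have xt : x 0 0 < t i by lra.
have Qt j : Q (to_face x + t j *: e) by apply: layer_slab => //; rewrite layer_gt0 layer_lt.
have d0 : 0 < t i - x 0 0 by rewrite subr_gt0.
have Qd : Q (x + (t i - x 0 0) *: e) by rewrite -to_faceK.
apply: le_trans (gradient_ge S Qx nbx d0 Qd).
rewrite -to_faceK.
have tt : t i.+1 < t i by lra.
have Qx' : Q (to_face x + x 0 0 *: e) by rewrite -xE.
have := slope_mono S xt tt (ltW hi) (lexx _) (slab_setOm S Qx') (slab_setOm S (Qt i))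
  (slab_setOm S (Qt i.+1)) (slab_setOm S (Qt i)).
rewrite -xE (_ : t i - t i.+1 = t i.+1); last lra.
rewrite /chord_slope /f => H.
rewrite -lerN2 -!mulNr !opprB; exact: H.
Qed.

(** The layers are disjoint, so at most one summand is nonzero. The first k layers end at t_(k+1),
    below which their partial sum is still 0. *)
Lemma layer_sum_le v : ~ bad_set u h (row_of_tuple v) ->
  (\sum_(i <oo) layer_fun i v <=
    (((fun x => enorm (gradient u x)) \_ Om) (row_of_tuple v) `^ p)%:E)%E.
Proof.
move=> nbv; set K := _%:E.
have K0 : (0 <= K)%E by rewrite lee_fin powR_ge0.
have tS i : t i = 2 * t i.+1 by exact: layerS.
have lay0 i : (thead v < t i.+2) || (t i.+1 <= thead v) -> layer_fun i v = 0%E.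
  move=> out; rewrite /layer_fun indicE memNset ?mul0r//= in_itv /=.
  by move=> /andP[lo hi]; move: out; rewrite ltNge lo leNgt hi.
have part k : (\sum_(0 <= i < k) layer_fun i v <= if (thead v < t k.+1)%R then 0 else K)%E.
  elim: k => [|k IH]; first by rewrite big_geq//; case: ifP.
  rewrite big_nat_recr//=; have := layer_gt0 k.+2 => tp.
  case: ifPn => [lt2|].
    rewrite lay0 ?lt2// adde0; apply: le_trans IH _.
    by rewrite ifT//; apply: lt_trans lt2 _; rewrite (tS k.+1); lra.
  rewrite -leNgt => ge2; move: IH; case: ifPn => [lt1 IH|].
    by rewrite -[leRHS]add0e; apply: leeD => //; exact: layer_fun_le.
  by rewrite -leNgt => ge1 IH; rewrite lay0 ?ge1 ?orbT// adde0.
apply: lime_le; first by apply: is_cvg_nneseries => *; exact: layer_fun_ge0.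
apply: nearW => k; apply: le_trans (part k) _; by case: ifP.
Qed.

(** On a line parallel to e_1 the chord slope of each layer is constant, so the layer contributes
    thickness times slope^p, and [dyadic_energy] bounds infinitely many of these below by one
    positive number. *)
Lemma layer_integral (y : m.+2.-tuple mR) : cube (fun=> 0) r y ->
  (\int[lebesgue_measure]_(s in setT) \sum_(i <oo) layer_fun i (tuple_of_cons (s, y)) = +oo)%E.
Proof.
move=> yr.
pose X (s : mR) : 'rV[R]_m.+3 := row_of_tuple (tuple_of_cons (s, y)).
have X0 s : X s 0 0 = s by rewrite mxE.
pose z := to_face (X 0).
have Xz s : to_face (X s) = z.
  apply/rowP => i; have [->|i0] := eqVneq i 0; first by rewrite /z !to_face0.
  rewrite /z !to_faceE// !mxE; move: i0; case: (unliftP 0 i) => [j ->|->] //.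
  by rewrite !tnthS.
have z0 : z 0 0 = 0 by exact: to_face0.
have zr : `|z| < r.
  apply/(rV_norm_lt _ r0) => i; have [->|i0] := eqVneq i 0; first by rewrite z0 normr0.
  rewrite to_faceE// mxE; move: i0; case: (unliftP 0 i) => [j ->|->] // _.
  by rewrite tnthS; have := yr j; rewrite -ball_normE /= sub0r normrN.
pose k i : R := (Num.max ((f z (t i.+1) - f z (t i)) / t i.+1) 0) `^ p.
have FE i (s : mR) : layer_fun i (tuple_of_cons (s, y)) =
    ((k i)%:E * (\1_(`[t i.+2, t i.+1[%classic : set R) s)%:E)%E.
  rewrite /layer_fun theadE patchE ifT; last by rewrite inE /V /= -/(X s) Xz.
  by rewrite -/(X s) /chord_slope Xz -EFinM mulrC.
have mI i : measurable (`[t i.+2, t i.+1[%classic : set mR) by exact: measurable_itv.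
rewrite integral_nneseries//; last 2 first.
- move=> i; under eq_fun do rewrite FE.
  apply: measurable_funeM; apply/measurable_EFinP; exact: measurable_indic.
- by move=> i s _; exact: layer_fun_ge0.
pose D := @dyadic_rate R m lambda h.
have D0 : 0 < D by exact: (dyadic_rate_gt0 S).
have ep0 : 0 < (2 * D / r) `^ p * r / 4.
  apply: divr_gt0 => //; apply: mulr_gt0 => //; apply: powR_gt0.
  by apply: divr_gt0 => //; exact: mulr_gt0.
apply: (nneseries_infinitely_often ep0).
  by move=> i; apply: integral_ge0 => s _; exact: layer_fun_ge0.
move=> j; have [i ji Hi] := dyadic_energy S s01 z0 zr (fun s => @low z s z0 zr) j.
exists i => //.
have tS : t i.+1 = 2 * t i.+2 by exact: layerS.
have tp := layer_gt0 i.+2.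
rewrite (eq_integral (fun s : mR => ((k i)%:E * (\1_(`[t i.+2, t i.+1[%classic : set R) s)%:E)%E));
  last by move=> s _; rewrite FE.
rewrite ge0_integralZl//; last 2 first.
- by apply/measurable_EFinP; exact: measurable_indic.
- by rewrite lee_fin powR_ge0.
rewrite integral_indic// setIT [X in (_ * X)%E]lebesgue_measure_itv /= lte_fin ifT; last by lra.
rewrite -EFinB -EFinM lee_fin (_ : t i.+1 - t i.+2 = t i.+2); last by lra.
by rewrite [leRHS]mulrC; exact: Hi.
Qed.

End Layers.

(** The sum [H] of the layer functions is measurable and, off the null bad set, below the p-th power
    of the gradient norm. Its integral is infinite on every line over a cube of positive measure. *)
Lemma gradient_Lp :
  Lp_norm Om p%:E (fun x => enorm (gradient u x)) = +oo%E.
Proof.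
pose g := fun x => enorm (gradient u x).
have [s0 s01 low] := drop_lower S.
pose F := layer_fun s0.
pose H (v : m.+3.-tuple mR) : \bar R := (\sum_(i <oo) F i v)%E.
have H0 v : (0 <= H v)%E by apply: nneseries_ge0 => *; exact: layer_fun_ge0.
have mH : measurable_fun setT H.
  apply: ge0_emeasurable_sum => [i v _ _|i _]; first exact: layer_fun_ge0.
  exact: measurable_layer_fun.
pose N := @row_of_tuple R _ @^-1` bad_set u h.
have mN : measurable N by exact: (measurable_bad_set S).
have Hinf : (\int[lebesgue_tuple m.+3]_v H v = +oo)%E.
  have mc := @measurable_tuple_of_cons R m.+2.
  transitivity (\int[pushforward (lebesgue_measure \x lebesgue_tuple m.+2)%E (@tuple_of_cons R m.+2)]_v H v)%E.
    by apply: eq_measure_integral => A mA _.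
  rewrite ge0_integral_pushforward//= preimage_setT.
  have mHc : measurable_fun setT (H \o @tuple_of_cons R m.+2) by exact: measurableT_comp.
  rewrite (fubini_tonelli2 _ mHc); last by move=> q; exact: H0.
  rewrite /fubini_G /=.
  have mC : measurable (cube (fun=> 0) r : set (m.+2.-tuple mR)) by exact: measurable_cube.
  have step : (\int[lebesgue_tuple m.+2]_y ((cst +oo%E) \_ (cube (fun=> 0%R) r)) y = +oo :> \bar R)%E.
    rewrite -integral_mkcond integral_cst// [X in (_ * X)%E](lebesgue_cube _ (ltW r0)) gt0_mulye//.
    by rewrite lte_fin exprn_gt0// pmulrn_lgt0.
  apply/eqP; rewrite -leye_eq -[X in (X <= _)%E]step.
  apply: ge0_le_integral_nonmeasurable => y; rewrite patchE.
    by case: ifP => // _; rewrite leey.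
  case: ifPn => [|_]; last by apply: integral_ge0 => s _; exact: H0.
  by rewrite inE => Cy; rewrite [leRHS](layer_integral s01 low Cy).
have Hle : (+oo <= \int[lebesgue_tuple m.+3]_v ((g \_ Om) (row_of_tuple v) `^ p)%:E)%E.
  rewrite -[X in (X <= _)%E]Hinf (ge0_negligible_integral mN measurableT mH); last 2 first.
  - by move=> v _; exact: H0.
  - exact: (null_bad_set S).
  rewrite integral_mkcond; apply: ge0_le_integral_nonmeasurable => v; rewrite patchE.
    by case: ifP.
  case: ifPn => [|_]; last by rewrite lee_fin powR_ge0.
  by rewrite inE => -[_ nb]; exact: layer_sum_le.
rewrite /Lp_norm unlock.
have -> : (\int[lebesgue_tuple m.+3]_v `|((g \_ Om) (row_of_tuple v))%:E| `^ p = +oo)%E.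
  apply/eqP; rewrite -leye_eq; apply: le_trans Hle _.
  apply: ge0_le_integral_nonmeasurable => v; first by rewrite lee_fin powR_ge0.
  rewrite /= ger0_norm// patchE; case: ifP => // _; exact: sqrtr_ge0.
by rewrite poweRyr// invr_neq0// gt_eqF.
Qed.

End GradientLp.

(** * Failure of Hoelder and Lipschitz bounds *)

Section NotHolder.
Context {R : realType} {m : nat}.
Variables (Om : set 'rV[R]_m.+2) (u : 'rV[R]_m.+2 -> R) (lambda h C c0 : R)
  (a : 'rV[R]_m.+2).
Hypothesis S : flat_setting Om u lambda h C c0 a.
Let e : 'rV[R]_m.+2 := delta_mx 0 0.

Lemma not_power_bound (al K : R) : 2 / m.+2%:R < al ->
  ~ (forall t, 0 < t < h / 8 -> u 0 - u (t *: e) <= K * (t `^ al + t)).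
Proof.
move=> al2 H; pose r := h / 8.
have r0 : 0 < r by rewrite divr_gt0//; exact: (fs_h S).
pose c := growth_const m.+2 * lambda `^ (m.+2%:R^-1) * r ^+ 2.
have c_gt0 : 0 < c := drop_const_gt0 S.
(* With t = s r, the assumed bound plus the linear error is at most D (s^al + s). *)
pose D := `|K| * (r `^ al + r) + `|C| * r.
have [s /andP[s0 s1]] := growth_dominates (D / c) (isT : (2 <= m.+2)%N) al2.
have sr : 0 < s * r < r by rewrite mulr_gt0//= gtr_pMl.
have z0 : (0 : 'rV[R]_m.+2) 0 0 = 0 by rewrite mxE.
have zr : `|0 : 'rV[R]_m.+2| < h / 8 by rewrite normr0.
have := growth_drop S z0 zr sr; rewrite -/r -/c mulfK ?gt_eqF// add0r => low.
have up := H _ sr.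
rewrite -(ltr_pM2l c_gt0) mulrA [c * _]mulrC divfK ?gt_eqF//.
apply/negP; rewrite -leNgt.
have {low up} := le_trans low up.
rewrite powRM ?(ltW s0) ?(ltW r0)// /D.
have p1 := powR_ge0 s al; have p2 := powR_ge0 r al.
move: (s `^ al) (r `^ al) p1 p2 => sa ra p1 p2.
have k0 : 0 <= `|K| by []. have g0 : 0 <= `|C| by [].
have s0' := ltW s0; have r0' := ltW r0.
have t1 : K * (sa * ra + s * r) <= `|K| * (sa * ra + s * r).
  by apply: ler_wpM2r (ler_norm K); apply: addr_ge0; exact: mulr_ge0.
have t2 : C * (s * r) <= `|C| * (s * r).
  by apply: ler_wpM2r (ler_norm C); exact: mulr_ge0.
have q1 : 0 <= `|K| * (ra * s) by apply: mulr_ge0 => //; exact: mulr_ge0.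
have q2 : 0 <= `|K| * (r * sa) by apply: mulr_ge0 => //; exact: mulr_ge0.
have q3 : 0 <= `|C| * (r * sa) by apply: mulr_ge0 => //; exact: mulr_ge0.
lra.
Qed.

Let bound_points t : 0 < t < h / 8 -> [/\ closure Om 0, closure Om (t *: e),
  enorm (0 - t *: e) = t & 0 < t].
Proof.
move=> /andP[t0 tr]; have h0 := fs_h S.
have z0 : (0 : 'rV[R]_m.+2) 0 0 = 0 by rewrite mxE.
have zh : `|0 : 'rV[R]_m.+2| < h by rewrite normr0.
have tn : `|t| < h by rewrite gtr0_norm//; lra.
have [E1 E2] := face_shift z0 zh tn; rewrite add0r in E1 E2.
split => //; first exact: (fs_face S).
  by apply: (slab_setOm S); split => //; rewrite E1.
by rewrite sub0r -scaleNr enormZ enorm_delta mulr1 normrN gtr0_norm.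
Qed.

Lemma not_holder (al : R) : 2 / m.+2%:R < al -> ~ holder_on al (closure Om) u.
Proof.
move=> al2 [K HK]; apply: (@not_power_bound _ `|K| al2) => t tr.
have [cz ct Et t0] := bound_points tr.
apply: le_trans (ler_norm _) _; apply: le_trans (HK _ _ cz ct) _; rewrite Et.
apply: (@le_trans _ _ (`|K| * t `^ al)).
  by apply: ler_wpM2r (ler_norm K); exact: powR_ge0.
by apply: ler_wpM2l => //; rewrite lerDl ltW.
Qed.

Lemma not_lipschitz : ~ lipschitz_on_set (closure Om) u.
Proof.
have al2 : 2 / m.+2%:R < 2 :> R by rewrite ltr_pdivrMr// ltr_pMr// ltr1n.
move=> [K HK]; apply: (@not_power_bound _ `|K| al2) => t tr.
have [cz ct Et t0] := bound_points tr.
apply: le_trans (ler_norm _) _; apply: le_trans (HK _ _ cz ct) _; rewrite Et.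
apply: (@le_trans _ _ (`|K| * t)).
  by apply: ler_wpM2r (ler_norm K); exact: ltW.
by apply: ler_wpM2l => //; rewrite lerDr powR_ge0.
Qed.

End NotHolder.

(** * The homothety [L] and the conclusion *)

Section Scaling.
Context {R : realType} {n : nat}.

Lemma scalar_unitmx (k : R) : 0 < k -> (k%:M : 'M[R]_n) \in unitmx.
Proof. by move=> k0; rewrite unitmxE det_scalar unitfE expf_neq0// gt_eqF. Qed.

Definition scaling (k : R) (k0 : 0 < k) : affine_bij R n :=
  AffineBij 0 (scalar_unitmx k0).

Lemma aff_scaling k (k0 : 0 < k) x : aff (scaling k0) x = k *: x.
Proof. by rewrite /aff /= mul_mx_scalar addr0. Qed.

Lemma aff_inv_scaling k (k0 : 0 < k) x : aff_inv (scaling k0) x = k^-1 *: x.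
Proof.
by rewrite -[RHS](affK (scaling k0)) aff_scaling scalerA divff ?scale1r// gt_eqF.
Qed.

End Scaling.

(* The dimension n >= 2 is m.+2. *)
Theorem theorem21 (R : realType) (m : nat) :
  exists2 Cn : R, 0 < Cn &
  exists CLg : affine_bij R m.+2 -> set ('rV[R]_m.+2 * R) -> R,
  forall (Om : set 'rV[R]_m.+2) (rho : R) (u : 'rV[R]_m.+2 -> R) (lambda : R),
    open Om -> bounded_set Om -> @convex_set R 'rV[R]_m.+2 Om ->
    0 < rho ->
    flat_ball rho `<=` closure Om -> closure Om `<=` half_space ->
    {within closure Om, continuous u} ->
    @convex_function R 'rV[R]_m.+2 (closure Om) u ->
    0 < lambda ->
    (forall A : set 'rV[R]_m.+2, borel A -> A `<=` Om ->
       (lambda%:E * lebesgue A <= monge_ampere Om u A)%E) ->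
    affine_on (flat_ball rho) u ->
    exists L : affine_bij R m.+2,
      [/\ flat_ball 2 `<=` aff L @` flat_ball rho `|` closure (cylinder 2 2),
          aff L @` flat_ball rho `|` closure (cylinder 2 2)
            `<=` aff L @` closure Om &
          aff L @` closure Om `<=` half_space] /\
      (* (1) *)
      ((forall x, (aff L @^-1` cylinder 1 1) x ->
          let x0 := aff_inv L (zero_fst (aff L x)) in
          let s := spectral_norm (lin_part L) * enorm (x - x0) in
          (m.+2 = 2%N -> 0 <= 2^-1 - ln s) /\
          u x0 - u x >=
            - CLg L (graph_on (boundary Om) u) * enorm (x - x0)
            + Cn * lambda `^ (m.+2%:R^-1)
                / `|\det (lin_part L)| `^ (2 / m.+2%:R)
              * growth m.+2 s) /\
       ~ lipschitz_on_set (closure Om) u /\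
       (forall alpha : R, 2 / m.+2%:R < alpha ->
          ~ holder_on alpha (closure Om) u)) /\
      (* (2) *)
      (Lp_norm Om +oo%E (fun x => enorm (gradient u x)) = +oo%E /\
       ((3 <= m.+2)%N ->
          Lp_norm Om (m.+2%:R / m%:R)%:E (fun x => enorm (gradient u x)) = +oo%E)).
Proof.
exists (growth_const m.+2); first exact: growth_const_gt0.
(* C_(L,g) = |L| sup |g|: for the homothety below this is 8 sup |g| / h, at least the slope 2 sup
   |g| / h of the linear bound. *)
exists (fun L G => spectral_norm (lin_part L) * boundary_sup G).
move=> Om rho u lambda oOm bOm cOm rho0 fOm hOm ctu cvu lambda0 MA afu.
have [h [c0 [a [S face]]]] :=
  exists_flat_setting oOm bOm cOm rho0 fOm hOm ctu cvu lambda0 MA afu.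
(* With k = 8 / h, the preimage of the unit cylinder lies in |x| < h / 8, where [growth_bound]
   holds, and those of the cylinder and the flat ball of size 2 stay within |x| < h. *)
have h0 := fs_h S; pose k := 8 / h.
have k0 : 0 < k by rewrite divr_gt0.
have kh : k * h = 8 by rewrite divfK// gt_eqF.
set B := boundary_sup (graph_on (boundary Om) u).
have B0 : 0 <= B.
  have bd0 : boundary Om 0.
    have z0 : (0 : 'rV[R]_m.+2) 0 0 = 0 by rewrite mxE.
    split; first by apply: (fs_face S) => //; rewrite normr0.
    by move=> /(@interior_subset _ Om) /(fst_gt0 oOm hOm); rewrite z0 ltxx.
  by apply: le_trans (boundary_sup_ub bOm ctu bd0).
pose L : affine_bij R m.+2 := scaling k0.
have aL x : aff L x = k *: x by exact: aff_scaling.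
have scaled_slab (x : 'rV[R]_m.+2) d : 0 < d <= 2 -> cylinder d d x ->
    0 < (k^-1 *: x) 0 0 /\ `|k^-1 *: x| < d * (h / 8).
  move=> /andP[d0 d2] [/andP[x0 xd] xo].
  have ki : k^-1 = h / 8 by rewrite /k invf_div.
  split; first by rewrite mxE mulr_gt0 ?invr_gt0.
  rewrite normrZ gtr0_norm ?invr_gt0// ki mulrC ltr_pM2r ?divr_gt0//.
  apply/(rV_norm_lt _ d0) => i; case: (unliftP 0 i) => [j ->|->].
    by apply: le_lt_trans xo; have := coord_le_enorm (other_coords x) j; rewrite mxE.
  by rewrite gtr0_norm.
have cylOm (x : 'rV[R]_m.+2) : cylinder 2 2 x -> Om (k^-1 *: x).
  move=> /scaled_slab[|x0 xh]; first by rewrite ltr0n /=.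
  by apply: (fs_slab S) => //; apply: lt_trans xh _; lra.
exists L; split.
  split.
  - move=> x [x0 xo]; left; exists (k^-1 *: x); last first.
      by rewrite aL scalerA divff ?scale1r// gt_eqF.
    apply: face; first by rewrite mxE; rewrite /fst_coord in x0; rewrite x0 mulr0.
    rewrite normrZ gtr0_norm ?invr_gt0// mulrC ltr_pdivrMr// mulrC kh.
    apply/(rV_norm_lt _ _) => // i; case: (unliftP 0 i) => [j ->|->].
      have := coord_le_enorm (other_coords x) j; rewrite mxE; lra.
    by rewrite /fst_coord in x0; rewrite x0 normr0.
  - move=> x [[y Fy <-]|cx]; first by exists y => //; exact: fOm.
    exists (k^-1 *: x); last by rewrite aL scalerA divff ?scale1r// gt_eqF.
    move=> W /nbhs_ballP[d /= d0 dW].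
    have kd : 0 < k * d by rewrite mulr_gt0.
    have [y [Cy /=]] := cx _ (nbhsx_ballx x _ kd); rewrite -ball_normE /= => xy.
    exists (k^-1 *: y); split; first exact: cylOm.
    apply: dW; rewrite -ball_normE /= -scalerBr normrZ gtr0_norm ?invr_gt0//.
    by rewrite mulrC ltr_pdivrMr// mulrC.
  - move=> _ [y cy <-]; rewrite /half_space /fst_coord /= aL mxE.
    by rewrite mulr_ge0 ?(ltW k0)//; exact: hOm.
split; last first.
  split; first exact: (gradient_Linfty S).
  case: m Om u oOm bOm cOm fOm hOm ctu cvu MA afu a S {face L aL scaled_slab cylOm B B0} => //.
  move=> m' Om u _ _ _ _ _ _ _ _ _ a S _; exact: (gradient_Lp S).
split; last by split; [exact: (not_lipschitz S)|move=> al; exact: (not_holder S)].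
move=> x Cx /=.
rewrite aff_inv_scaling aL.
have -> : k^-1 *: zero_fst (k *: x) = x - x 0 0 *: delta_mx 0 0.
  apply/rowP => i; rewrite !mxE; case: eqVneq => [->|i0]; first by rewrite mulr0 mulr1 subrr.
  by rewrite (mulKf (lt0r_neq0 k0)) andbF mulr0 subr0.
set z := x - _ *: _.
have [] := scaled_slab _ 1 _ Cx; first by rewrite ltr01 /= ler1n.
rewrite aL scalerA mulVf ?gt_eqF// scale1r mul1r => x0 xh.
have zx : enorm (x - z) = x 0 0.
  by rewrite /z subKr enormZ enorm_delta mulr1 gtr0_norm.
rewrite zx spectral_norm_scalar ?(ltW k0)//.
have xr : x 0 0 < h / 8.
  by apply: le_lt_trans ((rV_norm_lt _ (_ : 0 < h / 8)).1 xh 0); [exact: ler_norm|rewrite divr_gt0].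
have kx : k * x 0 0 = x 0 0 / (h / 8) by rewrite /k invf_div mulrC.
split.
  move=> _; have : ln (k * x 0 0) <= 0.
    by rewrite ln_le0// kx ler_pdivrMr ?divr_gt0// mul1r ltW.
  lra.
(* For a homothety |det L|^(2/n) = k^2, whose inverse is the factor (h / 8)^2 of [growth_bound]. *)
have detk : `|\det (lin_part L)| `^ (2 / m.+2%:R) = k ^+ 2.
  rewrite /= det_scalar ger0_norm ?exprn_ge0 ?(ltW k0)//.
  rewrite -powR_mulrn ?(ltW k0)// -powRrM mulrCA divff ?mulr1 ?pnatr_eq0//.
  by rewrite powR_mulrn// ltW.
rewrite detk.
have := growth_bound S x0 xh; rewrite -kx.
have z0 : z 0 0 = 0 by rewrite !mxE /= mulr1 subrr.
have zh : `|z| < h.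
  apply/(rV_norm_lt _ h0) => i; case: (eqVneq i 0) => [->|i0]; first by rewrite z0 normr0.
  rewrite /z !mxE (negbTE i0) andbF mulr0 subr0.
  apply: lt_trans ((rV_norm_lt _ (_ : 0 < h / 8)).1 xh i) _; [by rewrite divr_gt0|lra].
rewrite (fs_face_eq S z0 zh).
have -> : dotv a z = dotv a x by rewrite dotvDr dotvNr dotvZr dotv_delta (fs_slope S) mulr0 subr0.
have -> : growth_const m.+2 * lambda `^ m.+2%:R^-1 / k ^+ 2 * growth m.+2 (k * x 0 0)
  = growth_const m.+2 * lambda `^ m.+2%:R^-1 * (h / 8) ^+ 2 * growth m.+2 (k * x 0 0).
  by rewrite /k -exprVn invf_div.
have : 2 * B / h * x 0 0 <= k * B * x 0 0.
  have -> : k * B = 8 * B / h by rewrite /k mulrAC.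
  by rewrite ler_pM2r// ler_pM2r ?invr_gt0//; lra.
rewrite -/B; lra.
Qed.
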